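(* Let $n>2$, $V=\mathbb{C}^n$, $G=\mathrm{GL}(V)$ acting on $W=\mathrm{Sym}^nV$, and $\mathrm{Chow}_n=\{v_1\cdots v_n\mid v_i\in V\}\subseteq W$. Then $\mathrm{Sat}(S(\mathrm{Chow}_n))=\{\lambda\in\mathbb{Z}^n \text{ a partition (i.e. }\lambda_1\ge\dots\ge\lambda_n\ge 0) \mid |\lambda|\equiv 0\bmod n\}$.
   Context: Highest weights of $G$ are weakly decreasing vectors in $\mathbb{Z}^n$; $V_G(\lambda)$ is the irreducible rational $G$-module of highest weight $\lambda$; $|\lambda|=\sum_i\lambda_i$. $G$ acts on $\mathcal{O}(\mathrm{Chow}_n)$ by $(gF)(z)=F(g^{-1}z)$, and $S(\mathrm{Chow}_n)=\{\lambda\mid V_G(\lambda)^*\text{ occurs in }\mathcal{O}(\mathrm{Chow}_n)\}$, a submonoid of $\mathbb{Z}^n$. For a submonoid $S$ of $\mathbb{Z}^n$ with generated group $A(S)=S-S$, $S$ is saturated if $x\in A(S)$, $k\in\mathbb{N}_{>0}$, $kx\in S$ imply $x\in S$; $\mathrm{Sat}(S)$ is the smallest saturated submonoid of $\mathbb{Z}^n$ containing $S$. *)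

(* Defs.v *)
From HB Require Import structures.
From mathcomp Require Import all_boot all_order all_algebra.
From mathcomp Require Import mpoly.

Set Implicit Arguments.
Unset Strict Implicit.
Unset Printing Implicit Defensive.

Import GRing.Theory.
Local Open Scope ring_scope.

Section Lattice.
Variable n : nat.
Implicit Types (S T : 'rV[int]_n -> Prop) (x y lam : 'rV[int]_n).

Definition submonoid S : Prop := S 0 /\ (forall x y, S x -> S y -> S (x + y)).

Definition gen_group S x : Prop := exists a b, [/\ S a, S b & x = a - b].

Definition saturated S : Prop :=
  forall x (k : nat), gen_group S x -> (0 < k)%N -> S (x *+ k) -> S x.

Definition Sat S x : Prop :=
  forall T, submonoid T -> saturated T -> (forall y, S y -> T y) -> T x.

(* [Sat S] is indeed the smallest saturated submonoid containing [S]. *)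
Lemma Sat_smallest S :
  [/\ submonoid (Sat S), saturated (Sat S), forall x, S x -> Sat S x
    & forall T, submonoid T -> saturated T -> (forall x, S x -> T x) ->
        forall x, Sat S x -> T x].
Proof.
split.
- split=> [T [T0 _] _ _ //|x y Sx Sy T mT sT ST].
  by case: (mT) => _ TD; apply: TD; [apply: Sx|apply: Sy].
- move=> x k [a [b [Sa Sb xE]]] k_gt0 Skx T mT sT ST.
  apply: (sT x k) => //; last exact: Skx.
  by exists a, b; split=> //; [apply: Sa|apply: Sb].
- by move=> x Sx T _ _; apply.
- by move=> T mT sT ST x; apply.
Qed.

Definition dominant lam : Prop :=
  forall i j : 'I_n, (i <= j)%N -> lam 0 j <= lam 0 i.

Definition is_partition lam : Prop := dominant lam /\ (forall i, 0 <= lam 0 i).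

Definition wsize lam : int := \sum_i lam 0 i.

End Lattice.

Section RationalModules.
Variables (K : fieldType) (n : nat).

(* The group GL_n(K) is the set [unitmx] of invertible matrices; only the
   values of functions on [unitmx] matter. The coordinate ring of GL_n is
   K[g_11, ..., g_nn, 1/det]. *)
Definition regular_on_GL (f : 'M[K]_n -> K) : Prop :=
  exists (p : {mpoly K[n * n]}) (k : nat),
    forall g, g \in unitmx -> f g = p.@[fun i => mxvec g 0 i] / (\det g) ^+ k.

(* Finite-dimensional representations of GL_n whose matrix coefficients are
   regular functions. *)
Record rational_module := RationalModule {
  module_space :> vectType K;
  gl_act : 'M[K]_n -> 'End(module_space);
  gl_act1 : gl_act 1%:M = \1%VF;
  gl_actM : forall g h, g \in unitmx -> h \in unitmx ->
    gl_act (g *m h) = (gl_act g \o gl_act h)%VF;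
  gl_act_regular : forall (phi : 'Hom(module_space, K^o)) (v : module_space),
    regular_on_GL (fun g => phi (gl_act g v)) }.

Definition irreducible_module (M : rational_module) : Prop :=
  ({:M} != 0)%VS /\
  forall U : {vspace M},
    (forall g, g \in unitmx -> (gl_act M g @: U <= U)%VS) ->
    U = 0%VS \/ U = {:M}%VS.

Definition upper_unitriangular (u : 'M[K]_n) : Prop :=
  (forall i, u i i = 1) /\ (forall i j : 'I_n, (j < i)%N -> u i j = 0).

(* Weights are taken with respect to the diagonal torus, highest weights with
   respect to the upper triangular Borel subgroup. *)
Definition highest_weight_vector (M : rational_module) (lam : 'rV[int]_n)
    (v : M) : Prop :=
  [/\ v != 0,
      forall u, upper_unitriangular u -> gl_act M u v = v
    & forall t : 'rV[K]_n, (forall i, t 0 i != 0) ->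
        gl_act M (diag_mx t) v = (\prod_i t 0 i ^ lam 0 i) *: v].

Definition has_highest_weight (M : rational_module) (lam : 'rV[int]_n) : Prop :=
  exists v : M, highest_weight_vector lam v.

Definition dual_act (M : rational_module) (g : 'M[K]_n) (phi : 'Hom(M, K^o)) :
    'Hom(M, K^o) := (phi \o gl_act M (invmx g))%VF.

End RationalModules.

(* V = K^n is ['cV[K]_n] with standard basis e_1, ..., e_n, and Sym^d V is the
   space [dhomog n K d] of homogeneous polynomials of degree d in the e_i,
   where e_i is written ['X_i]. *)
Section SymmetricPowers.
Variables (K : fieldType) (n : nat).

Definition vec_poly (v : 'cV[K]_n) : {mpoly K[n]} := \sum_i v i 0 *: 'X_i.

Lemma vec_poly_homog v : vec_poly v \is 1.-homog.
Proof.
by apply: rpred_sum => i _; apply: rpredZ; rewrite dhomogX; apply/eqP/mdeg1.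
Qed.

(* e_j is sent to g e_j *)
Definition subst_act (g : 'M[K]_n) (p : {mpoly K[n]}) : {mpoly K[n]} :=
  p \mPo [tuple vec_poly (col j g) | j < n].

Lemma prod_homog (I : Type) (r : seq I) (f : I -> nat)
    (F : I -> {mpoly K[n]}) :
  (forall i, F i \is (f i).-homog) ->
  \prod_(i <- r) F i \is (\sum_(i <- r) f i).-homog.
Proof.
move=> hF; elim: r => [|i r IH]; first by rewrite !big_nil dhomog1.
by rewrite !big_cons; apply: dhomogM.
Qed.

Lemma subst_act_homog d g (w : dhomog n K d) :
  subst_act g (w : {mpoly K[n]}) \is d.-homog.
Proof.
have /dhomogP hw := dhomog_is_dhomog w.
rewrite /subst_act comp_mpolyE big_seq; apply: rpred_sum => m mw.
apply: rpredZ; rewrite -(hw m mw) /= mdegE; apply: prod_homog => i.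
rewrite tnth_mktuple -[X in X.-homog]mul1n.
by apply: dhomogMn; apply: vec_poly_homog.
Qed.

Definition sym_act d (g : 'M[K]_n) (w : dhomog n K d) : dhomog n K d :=
  DHomog (subst_act_homog g w).

Lemma subst_act_vec g v : subst_act g (vec_poly v) = vec_poly (g *m v).
Proof.
rewrite /subst_act /vec_poly raddf_sum /=.
under eq_bigr => j _ do
  rewrite comp_mpolyZ comp_mpolyXU -tnth_nth tnth_mktuple scaler_sumr.
rewrite exchange_big /=; apply: eq_bigr => i _.
rewrite mxE scaler_suml; apply: eq_bigr => j _.
by rewrite mxE scalerA mulrC.
Qed.

(* The elements v_1 ... v_n of Sym^n V. *)
Definition Chow (w : dhomog n K n) : Prop :=
  exists v : 'I_n -> 'cV[K]_n, (w : {mpoly K[n]}) = \prod_i vec_poly (v i).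

Lemma Chow_stable g w : Chow w -> Chow (sym_act g w).
Proof.
case=> v wE; exists (fun i => g *m v i).
rewrite /= wE /subst_act rmorph_prod /=.
by apply: eq_bigr => i _; rewrite -subst_act_vec.
Qed.

Definition Chow_pt : Type := {w : dhomog n K n | Chow w}.

Definition Chow_act (g : 'M[K]_n) (z : Chow_pt) : Chow_pt :=
  exist _ (sym_act g (proj1_sig z)) (Chow_stable g (proj2_sig z)).

End SymmetricPowers.

(* Polynomial functions on a finite-dimensional space W: polynomials in
   linear forms on W. *)
Definition polynomial_function (K : fieldType) (W : lmodType K) (F : W -> K) :
    Prop :=
  exists (N : nat) (l : 'I_N -> {scalar W}) (p : {mpoly K[N]}),
    forall w, F w = p.@[fun i => l i w].

Section ChowCoordinateRing.
Variables (K : fieldType) (n : nat).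

(* The elements of O(Chow_n): restrictions to Chow_n of polynomial functions
   on Sym^n V. *)
Definition regular_on_Chow (F : Chow_pt K n -> K) : Prop :=
  exists P : dhomog n K n -> K,
    polynomial_function P /\ forall z, F z = P (proj1_sig z).

Definition Chow_fun_act (g : 'M[K]_n) (F : Chow_pt K n -> K) :
    Chow_pt K n -> K := fun z => F (Chow_act (invmx g) z).

(* There is an injective morphism of GL_n-modules from the dual of M to
   O(Chow_n). *)
Definition dual_occurs_in_Chow (M : rational_module K n) : Prop :=
  exists Phi : 'Hom(M, K^o) -> (Chow_pt K n -> K),
    [/\ forall phi, regular_on_Chow (Phi phi),
        forall (a : K) phi psi z,
          Phi (a *: phi + psi) z = a * Phi phi z + Phi psi z,
        forall g phi, g \in unitmx ->
          Phi (dual_act g phi) =1 Chow_fun_act g (Phi phi)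
      & forall phi psi, Phi phi =1 Phi psi -> phi = psi].

(* V_G(lam) is determined up to isomorphism as the irreducible rational module
   of highest weight lam. *)
Definition S_Chow (lam : 'rV[int]_n) : Prop :=
  dominant lam /\
  exists M : rational_module K n,
    [/\ irreducible_module M, has_highest_weight M lam
      & dual_occurs_in_Chow M].

End ChowCoordinateRing.

(* Main.v *)
Require Import Defs.
From HB Require Import structures.
From mathcomp Require Import all_boot all_order all_algebra.
From mathcomp Require Import fingroup perm separable cyclic cyclotomic.
From mathcomp Require Import reals.
From mathcomp Require Import complex.
From mathcomp Require Import mpoly ring.
From Stdlib Require Import Classical IndefiniteDescription.
From Stdlib Require Import FunctionalExtensionality.

(* A module M with highest weight lam satisfies M^* <= O(Chow_n) exactly when
   there is a nonzero regular equivariant map from Chow_n to M. Scaling by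
   roots of unity and letting diag(1, .., eps, .., 1) degenerate then show that
   lam is a partition of a multiple of n.

   Conversely, inside a tensor power of V the standard Hermitian form, for
   which the adjoint of g is its conjugate transpose, makes orthogonal
   complements of submodules submodules. Hence every nonzero polynomial
   function on Chow_n that is invariant under lower unitriangular matrices and
   has weight lam under the torus puts lam in S(Chow_n). Two families of such
   functions are enough.

   - A positive multiple of each fundamental weight omega_k: the product f of
     the k x k minors of (v_1, .., v_n) is SL_k-invariant and integral over the
     functions of v_1 ... v_n. Averaging the coefficients of an integral
     equation over SL_k leaves a nonzero invariant coefficient.
   - Generators of the lattice n | |lam|: write y_j, x_j for the first two
     coordinates of v_j and replace x_j / y_j by its deviation from the mean.
     The coefficients of X^2 and X^3 in prod_j (y_j + x_j X) become invariant,
     with weights 2 (e_2 - e_1) and 3 (e_2 - e_1) modulo n e_1, and they do not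
     vanish because n > 2; determinants of the derivatives of this polynomial
     along the first k coordinates provide e_k - e_1. *)

Set Implicit Arguments.
Unset Strict Implicit.
Unset Printing Implicit Defensive.

Import Order.TTheory GRing.Theory Num.Theory.
Local Open Scope ring_scope.

(** * Homogeneous polynomial functions of a product of vectors *)

(** The predicate [P] need not be decidable, so excluded middle is used: [U] is enlarged by a vector
    of [P] outside it as long as one exists, and its codimension, at most [d], bounds the number of
    rounds. *)
Lemma vspace_of_pred (K : fieldType) (vT : vectType K) (P : vT -> Prop) :
    P 0 -> (forall a x y, P x -> P y -> P (a *: x + y)) ->
  exists U : {vspace vT}, forall x, x \in U <-> P x.
Proof.
move=> P0 PD.
suff H d (U : {vspace vT}) : (forall x, x \in U -> P x) ->
    (\dim {:vT} - \dim U <= d)%N ->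
    exists U : {vspace vT}, forall x, x \in U <-> P x.
  by apply: (H _ 0%VS _ (leqnn _)) => x; rewrite memv0 => /eqP->.
elim: d U => [|d IH] U UP dU.
  exists U => x; split; first exact: UP.
  have -> : U = fullv.
    by apply/eqP; rewrite eqEdim subvf /= -subn_eq0 -leqn0.
  by rewrite memvf.
case: (classic (exists2 x, P x & x \notin U)) => [[x Px xU]|nex]; last first.
  exists U => x; split; first exact: UP.
  by move=> Px; apply/negPn/negP => xU; apply: nex; exists x.
apply: (IH (U + <[x]>)%VS).
  move=> y /memv_addP[u uU [w /vlineP[a ->] ->]].
  by rewrite addrC; apply: PD => //; apply: UP.
have ltU : (\dim U < \dim (U + <[x]>))%N.
  rewrite ltnNge; apply/negP => le.
  have /eqP eU : U == (U + <[x]>)%VS by rewrite eqEdim addvSl.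
  by move: xU; rewrite eU memvE addvSr.
by move: dU; rewrite !leq_subLR => /leq_trans; apply; rewrite addnS -addSn leq_add2r.
Qed.

Section PolynomialFunctions.
Variables (K : fieldType) (W : lmodType K).
Implicit Types (F G : W -> K).

Lemma polynomial_function_cst (c : K) :
  polynomial_function (fun _ : W => c).
Proof.
exists 0%N, (fun=> \0 : {scalar W}), c%:MP => w.
by rewrite mevalC.
Qed.

Lemma polynomial_function_scalar (l : {scalar W}) : polynomial_function l.
Proof. by exists 1%N, (fun=> l), 'X_ord0 => w; rewrite mevalXU. Qed.

Lemma polynomial_function_op2 F G : polynomial_function F ->
    polynomial_function G ->
  exists N (l : 'I_N -> {scalar W}) (p q : {mpoly K[N]}),
    (forall w, F w = p.@[fun i => l i w]) /\
    (forall w, G w = q.@[fun i => l i w]).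
Proof.
case=> N1 [l1 [p1 E1]] [N2 [l2 [p2 E2]]].
exists (N1 + N2)%N, (fun i => match split i with inl j => l1 j | inr j => l2 j end).
exists (p1 \mPo [tuple 'X_(lshift N2 i) | i < N1]),
  (p2 \mPo [tuple 'X_(rshift N1 i) | i < N2]).
split=> w; rewrite comp_mpoly_meval ?E1 ?E2; apply: meval_eq => i;
  rewrite tnth_mktuple mevalXU.
  by rewrite -/(unsplit (inl i)) unsplitK.
by rewrite -/(unsplit (inr i)) unsplitK.
Qed.

Lemma polynomial_function_lin (a : K) F G : polynomial_function F ->
  polynomial_function G -> polynomial_function (fun w => a * F w + G w).
Proof.
move=> pF pG; have [N [l [p [q [E1 E2]]]]] := polynomial_function_op2 pF pG.
by exists N, l, (a *: p + q) => w; rewrite mevalD mevalZ E1 E2.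
Qed.

Lemma polynomial_function_mul F G : polynomial_function F ->
  polynomial_function G -> polynomial_function (fun w => F w * G w).
Proof.
move=> pF pG; have [N [l [p [q [E1 E2]]]]] := polynomial_function_op2 pF pG.
by exists N, l, (p * q) => w; rewrite mevalM E1 E2.
Qed.

End PolynomialFunctions.

Section HomogeneousRegular.
Variables (K : fieldType) (n : nat).
Local Notation tup := ('I_n -> 'cV[K]_n).
Implicit Types (v : tup) (xi : 'rV[K]_n) (F G : tup -> K).

Definition gtup (g : 'M[K]_n) v : tup := fun j => g *m v j.

Definition ev xi v : K := \prod_j (xi *m v j) 0 0.

Lemma ev_meval xi v : ev xi v = (\prod_j vec_poly (v j)).@[fun i => xi 0 i].
Proof.
rewrite rmorph_prod; apply: eq_bigr => j _.
rewrite mxE raddf_sum; apply: eq_bigr => i _.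
by rewrite /= mevalZ mevalXU mulrC.
Qed.

(* The functions [v |-> P (v_1 ... v_n)] with [P] homogeneous of degree [N] on
   [Sym^n V]; evaluations at points span the linear forms on [Sym^n V]. *)
Inductive homreg : nat -> (tup -> K) -> Prop :=
| homreg_ext N F G : homreg N F -> F =1 G -> homreg N G
| homreg_one : homreg 0 (fun=> 1)
| homreg_evM N xi F : homreg N F -> homreg N.+1 (fun v => ev xi v * F v)
| homreg_lin N a F G : homreg N F -> homreg N G ->
    homreg N (fun v => a * F v + G v).

Lemma homreg_ev xi : homreg 1 (ev xi).
Proof.
by apply: homreg_ext (homreg_evM xi homreg_one) _ => v; rewrite mulr1.
Qed.

Lemma homreg0 N : homreg N (fun=> 0).
Proof.
suff [F hF] : exists F, homreg N F.
  by apply: homreg_ext (homreg_lin (-1) hF hF) _ => v; rewrite mulN1r addNr.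
elim: N => [|N [F hF]]; first by eexists; apply: homreg_one.
by eexists; apply: (homreg_evM 0 hF).
Qed.

Lemma homregZ N a F : homreg N F -> homreg N (fun v => a * F v).
Proof.
by move=> hF; apply: homreg_ext (homreg_lin a hF (homreg0 N)) _ => v;
  rewrite addr0.
Qed.

Lemma homregD N F G : homreg N F -> homreg N G -> homreg N (fun v => F v + G v).
Proof.
by move=> hF hG; apply: homreg_ext (homreg_lin 1 hF hG) _ => v; rewrite mul1r.
Qed.

Lemma homreg_cst c : homreg 0 (fun=> c).
Proof. by apply: homreg_ext (homregZ c homreg_one) _ => v; rewrite mulr1. Qed.

Lemma homreg_sum N (I : Type) (r : seq I) (P : pred I) (F : I -> tup -> K) :
  (forall i, P i -> homreg N (F i)) ->
  homreg N (fun v => \sum_(i <- r | P i) F i v).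
Proof.
move=> hF; elim: r => [|i r IH].
  by apply: homreg_ext (homreg0 N) _ => v; rewrite big_nil.
case Pi: (P i).
  apply: homreg_ext (homregD (hF i Pi) IH) _ => v.
  by rewrite big_cons Pi.
by apply: homreg_ext IH _ => v; rewrite big_cons Pi.
Qed.

Lemma homregM N M F G : homreg N F -> homreg M G ->
  homreg (N + M) (fun v => F v * G v).
Proof.
elim=> {N F} [N F F' _ IH eF|hG|N xi F _ IH hG|N a F F' _ IH _ IH' hG].
- by move=> /IH h; apply: homreg_ext h _ => v /=; rewrite eF.
- by apply: homreg_ext hG _ => v; rewrite mul1r.
- by apply: homreg_ext (homreg_evM xi (IH hG)) _ => v; rewrite mulrA.
- apply: homreg_ext (homreg_lin a (IH hG) (IH' hG)) _ => v.
  by rewrite mulrDl mulrA.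
Qed.

Lemma homregX N F m : homreg N F -> homreg (m * N) (fun v => F v ^+ m).
Proof.
move=> hF; elim: m => [|m IH]; first exact: homreg_one.
by rewrite mulSn; apply: homreg_ext (homregM hF IH) _ => v; rewrite exprS.
Qed.

Lemma homreg_gtup N F g : homreg N F -> homreg N (fun v => F (gtup g v)).
Proof.
elim=> {N F} [N F F' _ IH eF||N xi F _ IH|N a F F' _ IH _ IH'].
- by apply: homreg_ext IH _ => v; rewrite eF.
- exact: homreg_one.
- apply: homreg_ext (homreg_evM (xi *m g) IH) _ => v; congr (_ * _).
  by apply: eq_bigr => j _; rewrite mulmxA.
- exact: homreg_lin.
Qed.

(** Each [ev xi] is a product of [n] linear factors, one per vector, so degree [N] on the symmetric
    power is degree [n * N] in the scalar. *)
Lemma homreg_scale N F (c : K) v : homreg N F ->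
  F (gtup c%:M v) = c ^+ (n * N) * F v.
Proof.
elim=> {N F} [N F F' _ IH eF||N xi F _ IH|N a F F' _ IH _ IH'].
- by rewrite -!eF.
- by rewrite muln0 mul1r.
- rewrite IH mulnS exprD mulrA [RHS]mulrA; congr (_ * _).
  rewrite mulrAC; congr (_ * _).
  rewrite /ev -[n in c ^+ n]card_ord -prodr_const -big_split /=.
  by apply: eq_bigr => j _; rewrite /gtup mul_scalar_mx -scalemxAr mxE.
- by rewrite IH IH' mulrDr mulrCA.
Qed.

(** In particular [F v] depends only on the product of the vectors: each [ev xi] is the evaluation
    of that product at [xi], which is linear in the product. *)
Lemma homreg_polynomial N F : homreg N F ->
  exists2 P : dhomog n K n -> K, polynomial_function P &
    forall (w : dhomog n K n) v,
      (w : {mpoly K[n]}) = \prod_j vec_poly (v j) -> F v = P w.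
Proof.
elim=> {N F} [N F F' _ [P pP hP] eF||N xi F _ [P pP hP]|
  N a F F' _ [P pP hP] _ [P' pP' hP']].
- by exists P => // w v /hP<-; rewrite eF.
- by exists (fun=> 1) => //; apply: polynomial_function_cst.
- pose l (w : dhomog n K n) := (w : {mpoly K[n]}).@[fun i => xi 0 i].
  have linl : scalar l by move=> a x y; rewrite /l /= mevalD mevalZ.
  pose lM := GRing.isLinear.Build K (dhomog n K n) K _ l linl.
  pose l' : {scalar dhomog n K n} := HB.pack l lM.
  exists (fun w => l' w * P w).
    apply: polynomial_function_mul pP; exact: polynomial_function_scalar.
  by move=> w v wE; rewrite -(hP w v wE) /= /l wE ev_meval.
- exists (fun w => a * P w + P' w); first exact: polynomial_function_lin.
  by move=> w v wE; rewrite (hP w v wE) (hP' w v wE).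
Qed.

End HomogeneousRegular.

(** * Tensor powers and their Hermitian form *)

Section Hermitian.
Variables (C : numClosedFieldType) (I : finType).
Local Notation E := {ffun I -> C^o}.
Implicit Types (x y z : E) (U : {vspace E}).

Definition dot x y : C := \sum_a (x a)^* * y a.

Lemma dot_conj x y : (dot x y)^* = dot y x.
Proof.
rewrite rmorph_sum; apply: eq_bigr => a _.
by rewrite rmorphM /= conjCK mulrC.
Qed.

Lemma dot_is_scalar x : scalar (dot x).
Proof.
move=> a y z; rewrite /dot mulr_sumr -big_split; apply: eq_bigr => b _.
by rewrite !ffunE mulrDr mulrCA.
Qed.

HB.instance Definition _ x := GRing.isLinear.Build C E C _ (dot x)
  (dot_is_scalar x).

Lemma dotC0 x y : dot x y = 0 -> dot y x = 0.
Proof. by move=> h; rewrite -dot_conj h conjC0. Qed.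

Lemma dotDl x y z : dot (x + y) z = dot x z + dot y z.
Proof. by rewrite -dot_conj linearD rmorphD /= !dot_conj. Qed.

Lemma dotZl a x y : dot (a *: x) y = a^* * dot x y.
Proof. by rewrite -dot_conj linearZ rmorphM /= !dot_conj. Qed.

Lemma dotBl x y z : dot (x - y) z = dot x z - dot y z.
Proof. by rewrite dotDl -scaleN1r dotZl rmorphN1 mulN1r. Qed.

Lemma dot_eq0 x : dot x x = 0 -> x = 0.
Proof.
move/eqP; rewrite psumr_eq0 => [/allP h|a _]; last by rewrite mulrC mul_conjC_ge0.
apply/ffunP => a; rewrite ffunE.
have := h a (mem_index_enum _); rewrite mulrC mul_conjC_eq0.
by move/eqP.
Qed.

(** Positivity of the form gives the trivial intersection. The sum is everything by a dimension
    count, since [U'] is cut out by [\dim U] linear equations. *)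
Lemma orth_complement U : exists U' : {vspace E},
  [/\ forall x, x \in U' <-> (forall u, u \in U -> dot u x = 0),
      (U :&: U' = 0)%VS & (U + U' = fullv)%VS].
Proof.
have [||U' hU'] := @vspace_of_pred _ E (fun x => forall u, u \in U -> dot u x = 0).
- by move=> u _; rewrite linear0.
- by move=> a x y hx hy u uU; rewrite linearP /= hx // hy // mulr0 addr0.
have UU' : (U :&: U' = 0)%VS.
  apply/eqP; rewrite -subv0; apply/subvP => x /memv_capP[xU /hU' xU'].
  by rewrite memv0; apply/eqP/dot_eq0/xU'.
exists U'; split=> //.
pose k := \dim U; pose b := vbasis U.
have linL : linear (fun x : E => \row_(i < k) dot (tnth b i) x : 'rV[C]_k).
  move=> a x y; apply/rowP => i.
  by rewrite !mxE linearP.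
pose LM := GRing.isLinear.Build C E 'rV[C]_k _ _ linL.
pose L : {linear E -> 'rV[C]_k} := HB.pack (fun x : E => \row_(i < k) dot (tnth b i) x : 'rV[C]_k) LM.
(* [L] pairs a vector with a basis of [U]; its image has dimension at most [k], so its kernel,
   contained in [U'], has codimension at most [k]. *)
have kerL : (lker (linfun L) <= U')%VS.
  apply/subvP => x; rewrite memv_ker lfunE => /eqP/rowP Lx; apply/hU' => u uU.
  rewrite (coord_vbasis uU); apply: dotC0; rewrite linear_sum big1 // => i _.
  rewrite linearZ /=; apply/eqP; rewrite mulf_eq0; apply/orP; right.
  apply/eqP/dotC0; have := Lx i; rewrite !mxE => <-.
  by rewrite -tnth_nth.
apply/eqP; rewrite eqEdim subvf /= dimv_disjoint_sum //.
rewrite -(limg_ker_dim (linfun L) fullv) addnC leq_add //.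
  have := dimvS (subvf (linfun L @: fullv)); rewrite dimvf /dim /= mul1n; exact.
by rewrite capfv (dimvS kerL).
Qed.

Lemma orth_decomp U x : exists u u',
  [/\ x = u + u', u \in U & forall w, w \in U -> dot w u' = 0].
Proof.
have [U' [hU' _ UU']] := orth_complement U.
have /memv_addP[u uU [u' u'U' ->]] : x \in (U + U')%VS by rewrite UU' memvf.
by exists u, u'; split=> //; apply/hU'.
Qed.

End Hermitian.

Section Tensors.
Variables (C : numClosedFieldType) (n N : nat).
Local Notation J := ('I_n * 'I_N)%type.
Local Notation word := {ffun J -> 'I_n}.
Local Notation E := {ffun word -> C^o}.
Local Notation tup := ('I_n -> 'cV[C]_n).
Implicit Types (x y q : E) (g h : 'M[C]_n) (v : tup).

(** The matrix of [g] on the tensor power of [V] of order [n * N]. Its basis is indexed by words,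
    and the tensor position [(j, l)] is meant for the copy number [l] of the vector [v j]. *)
Definition tmat g (a b : word) : C := \prod_i g (a i) (b i).

Definition tact g x : E := [ffun a => \sum_b tmat g a b * x b].

Lemma tact_is_linear g : linear (tact g).
Proof.
move=> c x y; apply/ffunP => a; rewrite !ffunE scaler_sumr -big_split /=.
by apply: eq_bigr => b _; rewrite !ffunE mulrDr mulrCA.
Qed.
HB.instance Definition _ g := GRing.isLinear.Build C E E _ (tact g)
  (tact_is_linear g).

Lemma tact1 x : tact 1%:M x = x.
Proof.
apply/ffunP => a; rewrite ffunE (bigD1 a) //= /tmat big1 => [|i _]; last first.
  by rewrite mxE eqxx.
rewrite mul1r big1 ?addr0 // => b nba.
have [i ni] : exists i, b i != a i.
  apply/existsP; rewrite -negb_forall; apply: contra nba => /forallP e.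
  by apply/eqP/ffunP => i; apply/eqP.
by rewrite (bigD1 i) //= mxE eq_sym (negPf ni) !mul0r.
Qed.

Lemma tactM g h x : tact (g *m h) x = tact g (tact h x).
Proof.
apply/ffunP => a; rewrite !ffunE.
under [RHS]eq_bigr do rewrite ffunE mulr_sumr.
rewrite exchange_big /=; apply: eq_bigr => c _.
under [RHS]eq_bigr do rewrite mulrA.
rewrite -mulr_suml; congr (_ * _); rewrite /tmat.
under eq_bigr do rewrite mxE.
rewrite bigA_distr_bigA /=.
by apply: eq_bigr => b _; rewrite -big_split.
Qed.

Definition adjmx g : 'M[C]_n := map_mx Num.conj g^T.

Lemma adjmxK g : adjmx (adjmx g) = g.
Proof. by apply/matrixP => i j; rewrite !mxE conjCK. Qed.

Lemma adjmx_unit g : g \in unitmx -> adjmx g \in unitmx.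
Proof. by move=> gu; rewrite map_unitmx unitmx_tr. Qed.

Lemma dot_tact g x y : dot (tact g x) y = dot x (tact (adjmx g) y).
Proof.
rewrite /dot.
under eq_bigr => a _ do rewrite ffunE rmorph_sum mulr_suml.
rewrite exchange_big; apply: eq_bigr => b _.
rewrite ffunE mulr_sumr; apply: eq_bigr => a _.
rewrite rmorphM /= -mulrA mulrCA; congr (_ * (_ * _)).
by rewrite /tmat rmorph_prod; apply: eq_bigr => i _; rewrite !mxE.
Qed.

(* The tensor [v_1^N (x) ... (x) v_n^N]. *)
Definition psi v : E := [ffun a : word => \prod_i v i.1 (a i) 0].

Lemma tact_psi g v : tact g (psi v) = psi (gtup g v).
Proof.
apply/ffunP => a; rewrite !ffunE /gtup.
under [RHS]eq_bigr => i _ do rewrite mxE.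
rewrite bigA_distr_bigA /=; apply: eq_bigr => b _.
by rewrite ffunE /tmat -big_split.
Qed.

Definition tfun q v : C := dot q (psi v).

(** The adjoint exchanges upper and lower unitriangular matrices. This is why tensors fixed by the
    upper group come from functions invariant under the lower one. *)
Lemma tfun_tact g q v : tfun (tact g q) v = tfun q (gtup (adjmx g) v).
Proof. by rewrite /tfun dot_tact tact_psi. Qed.

Lemma tmat_regular (c : word -> word -> C) :
  regular_on_GL (fun g => \sum_a \sum_b c a b * tmat g a b).
Proof.
exists (\sum_a \sum_b c a b *: \prod_i 'X_(mxvec_index (a i) (b i))), 0%N => g _.
rewrite expr0 divr1 raddf_sum; apply: eq_bigr => a _ /=.
rewrite raddf_sum; apply: eq_bigr => b _ /=.
rewrite mevalZ rmorph_prod /=; congr (_ * _); apply: eq_bigr => i _.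
by rewrite mevalXU mxvecE.
Qed.

End Tensors.

(** A product of [N] evaluations pairs the [l]-th row vector with the [l]-th copy of every [v j], so
    it is a linear form evaluated at [psi v], given by a decomposable tensor. *)
Lemma homreg_tfun (C : numClosedFieldType) n N (F : ('I_n -> 'cV[C]_n) -> C) :
  homreg N F -> exists q : {ffun {ffun 'I_n * 'I_N -> 'I_n} -> C^o}, F =1 tfun q.
Proof.
suff hspan (G : _ -> C) : homreg N G ->
    exists s : seq (C * ('I_N -> 'rV[C]_n)),
      G =1 fun v => \sum_(x <- s) x.1 * \prod_l ev (x.2 l) v.
  move=> /hspan[s sE].
  (* The conjugates compensate for [dot] being conjugate-linear in its first argument. *)
  exists (\sum_(x <- s) x.1^* *: ([ffun a : {ffun 'I_n * 'I_N -> 'I_n} => \prod_i (x.2 i.2 0 (a i))^*] :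
    {ffun {ffun 'I_n * 'I_N -> 'I_n} -> C^o})) => v.
  rewrite sE /tfun; elim: s {sE} => [|x s IH].
    by rewrite !big_nil /dot big1 // => a _; rewrite ffunE conjC0 mul0r.
  rewrite !big_cons dotDl -IH dotZl conjCK; congr (_ * _ + _).
  rewrite /ev /dot exchange_big /= pair_bigA /=.
  under eq_bigr => i _ do rewrite mxE.
  rewrite bigA_distr_bigA /=; apply: eq_bigr => a _.
  rewrite !ffunE rmorph_prod -big_split /=.
  by apply: eq_bigr => i _; rewrite conjCK.
elim=> {G} [M G G' _ [s sE] eG||M xi G _ [s sE]|M a G G' _ [s sE] _ [s' sE']].
- by exists s => v; rewrite -eG sE.
- exists [:: (1, fun=> 0)] => v; rewrite big_seq1 /= big1 ?mulr1 //.
  by case.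
- exists [seq (x.1, fun l => oapp x.2 xi (unlift ord0 l)) | x <- s] => v.
  rewrite sE big_map mulr_sumr; apply: eq_bigr => x _ /=.
  rewrite big_ord_recl unlift_none /= mulrCA; congr (_ * (_ * _)).
  by apply: eq_bigr => l _; rewrite liftK.
- exists ([seq (a * x.1, x.2) | x <- s] ++ s') => v.
  rewrite sE sE' big_cat big_map mulr_sumr /=; congr (_ + _).
  by apply: eq_bigr => x _; rewrite mulrA.
Qed.

(** * From highest weight functions to highest weight modules *)

Lemma min_dim_vspace (K : fieldType) (vT : vectType K)
    (P : {vspace vT} -> Prop) U : P U ->
  exists X, P X /\ forall Y, P Y -> (\dim X <= \dim Y)%N.
Proof.
have [d] := ubnP (\dim U); elim: d U => // d IH U dU PU.
case: (classic (exists2 Y, P Y & (\dim Y < \dim U)%N)) => [[Y PY dY]|nex].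
  by apply: (IH Y) => //; apply: leq_trans dY _.
exists U; split=> // Y PY; rewrite leqNgt; apply/negP => dY.
by apply: nex; exists Y.
Qed.

Lemma dot_riesz (C : numClosedFieldType) (I : finType)
    (L : {scalar {ffun I -> C^o}}) : exists q, forall y, L y = dot q y.
Proof.
pose de a : {ffun I -> C^o} := [ffun b => (b == a)%:R].
exists [ffun a => (L (de a))^*] => y.
have {1}-> : y = \sum_a (y a : C) *: de a.
  apply/ffunP => b; rewrite sum_ffunE (bigD1 b) //= big1 ?addr0.
    by rewrite !ffunE eqxx /GRing.scale /= mulr1.
  move=> a nab; rewrite !ffunE eq_sym (negPf nab).
  by rewrite /GRing.scale /= mulr0.
rewrite linear_sum; apply: eq_bigr => a _.
by rewrite linearZ ffunE /= conjCK mulrC.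
Qed.

Section Submodule.
Variables (C : numClosedFieldType) (n N : nat).
Local Notation word := {ffun 'I_n * 'I_N -> 'I_n}.
Local Notation E := {ffun word -> C^o}.
Local Notation tup := ('I_n -> 'cV[C]_n).

Definition stable (U : {vspace E}) :=
  forall g, g \in unitmx -> forall x, x \in U -> tact g x \in U.

Lemma stable_orth U x g : stable U -> g \in unitmx ->
  (forall u, u \in U -> dot u x = 0) ->
  forall u, u \in U -> dot u (tact g x) = 0.
Proof.
move=> sU gu hx u uU; rewrite -[g]adjmxK -dot_tact; apply: hx.
exact/sU/uU/adjmx_unit.
Qed.

Variables (X : {vspace E}) (sX : stable X).

(** The projection [vsproj] makes this an endomorphism for every matrix [g]; stability of [X]
    ensures that it changes nothing when [g] is invertible. *)
Definition sub_tact g (x : subvs_of X) : subvs_of X := vsproj X (tact g (vsval x)).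

Lemma sub_tact_is_linear g : linear (sub_tact g).
Proof. by move=> a x y; rewrite /sub_tact !linearP. Qed.
HB.instance Definition _ g := GRing.isLinear.Build C (subvs_of X) (subvs_of X) _
  (sub_tact g) (sub_tact_is_linear g).

Lemma vsval_sub_tact g x : g \in unitmx ->
  vsval (linfun (sub_tact g) x) = tact g (vsval x).
Proof. by move=> gu; rewrite lfunE /= vsprojK // sX // subvsP. Qed.

Lemma sub_tact1 : linfun (sub_tact 1%:M) = \1%VF.
Proof.
by apply/lfunP => x; rewrite !lfunE /= /sub_tact tact1 vsvalK.
Qed.

Lemma sub_tactM g h : g \in unitmx -> h \in unitmx ->
  linfun (sub_tact (g *m h)) = (linfun (sub_tact g) \o linfun (sub_tact h))%VF.
Proof.
move=> gu hu; apply/lfunP => x; apply/val_inj.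
have ghu : g *m h \in unitmx by rewrite unitmx_mul gu.
by rewrite /= comp_lfunE !vsval_sub_tact // tactM.
Qed.

Lemma sub_tact_regular (phi : 'Hom(subvs_of X, C^o)) (v : subvs_of X) :
  regular_on_GL (fun g => phi (linfun (sub_tact g) v)).
Proof.
have linL : scalar (fun y : E => phi (vsproj X y)) by move=> a x y; rewrite !linearP.
pose LM := GRing.isLinear.Build C E C _ _ linL.
pose L : {scalar E} := HB.pack (fun y : E => phi (vsproj X y)) LM.
have [q qE] := dot_riesz L.
have [p [k pk]] := tmat_regular (fun a b => (q a)^* * vsval v b).
exists p, k => g gu; rewrite -pk // lfunE /= /sub_tact -[LHS]/(L _) qE /dot.
apply: eq_bigr => a _; rewrite ffunE mulr_sumr; apply: eq_bigr => b _.
by rewrite mulrCA mulrC.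
Qed.

Definition sub_module : rational_module C n :=
  RationalModule sub_tact1 sub_tactM sub_tact_regular.

Lemma sub_module_irreducible : (exists2 x, x \in X & x != 0) ->
  (forall U, stable U -> (U <= X)%VS -> U = 0%VS \/ U = X) ->
  irreducible_module sub_module.
Proof.
move=> [x xX nx] irr; split.
  apply/eqP => e; have : vsproj X x \in {:subvs_of X}%VS by rewrite memvf.
  rewrite e memv0 => /eqP/(congr1 vsval).
  by rewrite vsprojK // linear0; apply/eqP.
move=> U sU; pose U' := (linfun (@vsval C E X) @: U)%VS.
have memU' y : y \in U -> vsval y \in U'.
  by move=> yU; rewrite -[vsval y]/((@vsval C E X) y) -lfunE memv_img.
have U'P z : z \in U' -> exists2 y, y \in U & z = vsval y.
  by move=> /memv_imgP[y yU ->]; exists y; rewrite ?lfunE.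
have sU' : stable U'.
  move=> g gu z /U'P[y yU ->]; rewrite -vsval_sub_tact //; apply: memU'.
  by move/subvP: (sU g gu); apply; apply: memv_img.
have U'X : (U' <= X)%VS by apply/subvP => z /U'P[y _ ->]; apply: subvsP.
have [U'0|U'e] := irr U' sU' U'X.
  left; apply/eqP; rewrite -subv0; apply/subvP => y yU.
  have := memU' y yU; rewrite U'0 !memv0 => /eqP e.
  by apply/eqP/val_inj; rewrite [LHS]e.
right; apply/eqP; rewrite eqEsubv subvf /=; apply/subvP => y _.
have /U'P[y' y'U /val_inj e] : vsval y \in U' by have := subvsP y; rewrite -{2}U'e.
by rewrite e.
Qed.

End Submodule.

Section Criterion.
Variables (C : numClosedFieldType) (n N : nat).
Local Notation word := {ffun 'I_n * 'I_N -> 'I_n}.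
Local Notation E := {ffun word -> C^o}.
Local Notation tup := ('I_n -> 'cV[C]_n).

Definition lower_unitriangular (l : 'M[C]_n) : Prop :=
  (forall i, l i i = 1) /\ (forall i j : 'I_n, (i < j)%N -> l i j = 0).

Lemma prod_vec_poly_homog (v : tup) : \prod_j vec_poly (v j) \is n.-homog.
Proof.
rewrite -[X in X.-homog]muln1 -[n in (n * _)%N]card_ord -sum_nat_const.
by apply: prod_homog => i; apply: vec_poly_homog.
Qed.

Definition chow_point (v : tup) : Chow_pt C n :=
  exist _ (DHomog (prod_vec_poly_homog v)) (ex_intro _ v erefl).

(** An arbitrary choice of factorization. The functions applied to it below depend only on the
    product, so the choice does not matter. *)
Definition factors (z : Chow_pt C n) : tup :=
  proj1_sig (constructive_indefinite_description _ (proj2_sig z)).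

Lemma factorsE z : (val (proj1_sig z)) = \prod_j vec_poly (factors z j).
Proof. exact: (proj2_sig (constructive_indefinite_description _ (proj2_sig z))). Qed.

Lemma Chow_actE g (z : Chow_pt C n) v :
  val (proj1_sig z) = \prod_j vec_poly (v j) ->
  val (proj1_sig (Chow_act g z)) = \prod_j vec_poly (gtup g v j).
Proof.
move=> zE; rewrite /= -[mpoly_of_dhomog _]/(val (proj1_sig z)) zE.
rewrite /subst_act rmorph_prod; apply: eq_bigr => j _.
by rewrite -subst_act_vec.
Qed.

(** * Embedding the dual of a tensor submodule in the coordinate ring *)

Section Occurrence.
Variables (X : {vspace E}) (sX : stable X).
Hypothesis regX : forall q, q \in X -> homreg N (tfun q).
Hypothesis injX : forall q, q \in X -> (forall v, tfun q v = 0) -> q = 0.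

(** A linear form on [X] is extended by the orthogonal projection [pi], which is equivariant because
    the complement of [X] is stable. The extension is [dot q] with [q] in [X], so the resulting
    function is [tfun q]: [regX] makes it regular on the Chow variety and [injX] makes the map
    injective. *)
Lemma sub_module_occurs : dual_occurs_in_Chow (sub_module sX).
Proof.
have [X' [X'P XX' XX'f]] := orth_complement X.
pose pi := daddv_pi X X'.
have piX x : x \in X -> pi x = x by apply: daddv_pi_id.
have piX' x : x \in X' -> pi x = 0.
  move=> xX'; have := @daddv_pi_add _ _ X X' x XX'; rewrite XX'f memvf => /(_ isT).
  rewrite [X in _ + X]daddv_pi_id // => [/(canRL (addrK _))|]; first by rewrite subrr.
  by rewrite capvC.
have piP y : pi y \in X by apply: memv_pi.
have pi_tact g y : g \in unitmx -> pi (tact g y) = tact g (pi y).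
  move=> gu; have : y \in (X + X')%VS by rewrite XX'f memvf.
  move=> /memv_addP[x xX [x' x'X' ->]].
  rewrite !linearD /= piX ?sX // [pi x]piX // piX'; last first.
    by apply/X'P; apply: stable_orth => //; apply/X'P.
  by rewrite piX' // linear0.
have phiP (phi : 'Hom(subvs_of X, C^o)) : exists2 q, q \in X &
    forall y, phi (vsproj X (pi y)) = dot q y.
  have linL : scalar (fun y : E => phi (vsproj X (pi y))).
    by move=> a x y; rewrite !linearP.
  pose LM := GRing.isLinear.Build C E C _ _ linL.
  have [q /= qE] := dot_riesz (HB.pack (fun y : E => phi (vsproj X (pi y))) LM).
  exists q => //; have : q \in (X + X')%VS by rewrite XX'f memvf.
  move=> /memv_addP[x xX [x' x'X' eq]].
  (* The component [x'] of [q] is killed by the extended form, so it is orthogonal to itself. *)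
  suff -> : q = x by [].
  rewrite eq (_ : x' = 0) ?addr0 //; apply: dot_eq0.
  have := qE x'; rewrite piX' // !linear0 {1}eq dotDl.
  by move/X'P: x'X' => ->//; rewrite add0r.
have tfun_pt q v w : q \in X -> \prod_j vec_poly (v j) = \prod_j vec_poly (w j) ->
    tfun q v = tfun q w.
  move=> qX e; have [P _ PE] := homreg_polynomial (regX qX).
  by rewrite (PE (proj1_sig (chow_point v)) v) // (PE (proj1_sig (chow_point v)) w).
exists (fun (phi : 'Hom(subvs_of X, C^o)) z => phi (vsproj X (pi (psi N (factors z))))).
split.
- move=> phi; have [q qX qE] := phiP phi.
  have [P pP PE] := homreg_polynomial (regX qX).
  exists P; split=> // z; rewrite qE -[dot _ _]/(tfun q _); apply: PE.
  exact: factorsE.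
- by move=> a phi psi z; rewrite add_lfunE scale_lfunE.
- move=> g phi gu z; have gu' : invmx g \in unitmx by rewrite unitmx_inv.
  have [q qX qE] := phiP phi.
  rewrite /Chow_fun_act qE /dual_act comp_lfunE.
  rewrite -[gl_act _ _]/(linfun (@sub_tact _ _ _ X (invmx g))) lfunE /= /sub_tact.
  rewrite vsprojK // -pi_tact // qE tact_psi; apply: tfun_pt => //.
  by rewrite -factorsE (Chow_actE _ (factorsE z)).
- move=> phi phi' e; have [q qX qE] := phiP phi; have [q' q'X q'E] := phiP phi'.
  suff eqq : q = q'.
    by apply/lfunP => x; rewrite -[x]vsvalK -[vsval x]piX ?subvsP // qE q'E eqq.
  apply/eqP; rewrite -subr_eq0; apply/eqP/injX; first exact: rpredB.
  move=> v; rewrite /tfun dotBl -!/(tfun _ v).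
  have fz : \prod_j vec_poly (v j) = \prod_j vec_poly (factors (chow_point v) j).
    by rewrite -factorsE.
  rewrite (tfun_pt _ _ _ qX fz) (tfun_pt _ _ _ q'X fz).
  by rewrite /tfun -qE -q'E e subrr.
Qed.

End Occurrence.
End Criterion.

Section CriterionMain.
Variables (C : numClosedFieldType) (n N : nat).
Local Notation word := {ffun 'I_n * 'I_N -> 'I_n}.
Local Notation E := {ffun word -> C^o}.
Local Notation tup := ('I_n -> 'cV[C]_n).

Lemma adjmx_upper (u : 'M[C]_n) : upper_unitriangular u -> lower_unitriangular (adjmx u).
Proof.
by case=> u1 u0; split=> [i|i j ij]; rewrite !mxE ?u1 ?conjC1 // u0 // conjC0.
Qed.

Lemma unitriangular_unit (u : 'M[C]_n) : upper_unitriangular u -> u \in unitmx.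
Proof.
case=> u1 u0; rewrite unitmxE -det_tr det_trig.
  by rewrite big1 ?unitr1 // => i _; rewrite mxE u1.
by apply/is_trig_mxP => i j ij; rewrite mxE u0.
Qed.

(** [P] is represented by a tensor [p]. A stable subspace [X] of minimal dimension among those not
    orthogonal to [p] is irreducible, and the orthogonal projection of [p] to [X] is a highest
    weight vector. *)
Lemma S_Chow_criterion (P : tup -> C) (lam : 'rV[int]_n) :
  homreg N P ->
  (forall l v, lower_unitriangular l -> P (gtup l v) = P v) ->
  (forall (t : 'rV_n) v, (forall i, t 0 i != 0) ->
     P (gtup (diag_mx t) v) = (\prod_i t 0 i ^ lam 0 i) * P v) ->
  (exists v, P v != 0) -> dominant lam -> S_Chow C lam.
Proof.
move=> hP Plow Ptor [v0 Pv0] dlam; split=> //.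
have tfunD a q r v : tfun (a *: q + r : E) v = a^* * tfun q v + tfun r v.
  by rewrite /tfun dotDl dotZl.
have [||Kn KnP] := @vspace_of_pred _ E (fun q => forall v, tfun q v = 0).
- by move=> v; rewrite /tfun -dot_conj linear0 conjC0.
- by move=> a q r hq hr v; rewrite tfunD hq hr mulr0 addr0.
have sKn : stable Kn.
  by move=> g _ q /KnP hq; apply/KnP => v; rewrite tfun_tact.
(* Restricting to tensors orthogonal to [Kn], those that give the zero function, makes [tfun]
   injective on [Q]. *)
have [||Q QP] := @vspace_of_pred _ E
  (fun q => homreg N (tfun q) /\ forall k, k \in Kn -> dot k q = 0).
- split=> [|k _]; last by rewrite linear0.
  by apply: homreg_ext (homreg0 _ _ N) _ => v; rewrite /tfun -dot_conj linear0 conjC0.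
- move=> a q r [hq oq] [hr or]; split; last first.
    by move=> k kK; rewrite linearP /= oq // or // mulr0 addr0.
  by apply: homreg_ext (homreg_lin a^* hq hr) _ => v; rewrite tfunD.
have sQ : stable Q.
  move=> g gu q /QP[hq oq]; apply/QP; split; last exact: stable_orth.
  by apply: homreg_ext (homreg_gtup (adjmx g) hq) _ => v; rewrite tfun_tact.
have injQ q : q \in Q -> (forall v, tfun q v = 0) -> q = 0.
  by move=> /QP[_ oq] /KnP qK; apply/dot_eq0/oq.
have [p [pQ pE]] : exists p, p \in Q /\ forall v, tfun p v = P v.
  have [p0 p0E] := homreg_tfun hP.
  have [k [p [eP kK pK]]] := orth_decomp Kn p0.
  have pE v : tfun p v = P v.
    rewrite p0E eP /tfun dotDl -!/(tfun _ v).
    by move/KnP: kK => ->; rewrite add0r.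
  by exists p; split=> //; apply/QP; split=> //; apply: homreg_ext hP _.
(* Injectivity on [Q] turns a semi-invariance of the function [P] into one of the tensor [p]; the
   eigenvalue is conjugated because [tfun] is conjugate-linear in the tensor. *)
have pg g c : g \in unitmx -> (forall v, P (gtup (adjmx g) v) = c^* * P v) ->
    tact g p = c *: p.
  move=> gu Pg; apply/eqP; rewrite -subr_eq0; apply/eqP/injQ.
    by rewrite rpredB ?rpredZ // sQ.
  move=> v; rewrite /tfun dotBl dotZl -!/(tfun _ v) tfun_tact !pE Pg.
  by rewrite subrr.
have np : p != 0.
  by apply: contraNneq Pv0 => p0; rewrite -pE p0 /tfun -dot_conj linear0 conjC0.
pose good (X : {vspace E}) :=
  [/\ stable X, (X <= Q)%VS & exists2 x, x \in X & dot x p != 0].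
have [X [[sX XQ [x xX xp]] minX]] : exists X, good X /\ forall Y, good Y ->
    (\dim X <= \dim Y)%N.
  apply: (@min_dim_vspace _ _ _ Q); split=> //; exists p => //.
  by apply: contraNneq np => /dot_eq0->.
have [x0 [y [pxy x0X yX]]] := orth_decomp X p.
have nx0 : x0 != 0.
  by apply: contraNneq xp => x00; rewrite pxy x00 add0r yX.
have x0g g c : g \in unitmx -> (forall v, P (gtup (adjmx g) v) = c^* * P v) ->
    tact g x0 = c *: x0.
  move=> gu Pg; apply/eqP; rewrite -subr_eq0; apply/eqP.
  have dX : tact g x0 - c *: x0 \in X by rewrite rpredB ?rpredZ ?sX.
  (* The left side lies in [X] and the right side is orthogonal to [X], so both vanish. *)
  have e : tact g x0 - c *: x0 = - (tact g y - c *: y).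
    apply/eqP; rewrite -addr_eq0 addrACA -opprD -scalerDr -linearD /= -pxy.
    by rewrite (pg g c) // subrr.
  apply: dot_eq0; rewrite {2}e; move: (_ - _) dX => w wX.
  by rewrite linearN linearB linearZ /= yX // (stable_orth sX gu yX) // mulr0 subr0 oppr0.
exists (sub_module sX); split.
- apply: sub_module_irreducible; first by exists x0.
  move=> U sU UX; have [||U' U'P] := @vspace_of_pred _ E
    (fun z => z \in X /\ forall u, u \in U -> dot u z = 0).
  - by split=> [|u _]; rewrite ?mem0v ?linear0.
  - move=> a z w [zX oz] [wX ow]; split; first by rewrite rpredD ?rpredZ.
    by move=> u uU; rewrite linearP /= oz // ow // mulr0 addr0.
  have U'X : (U' <= X)%VS by apply/subvP => z /U'P[].
  have sU' : stable U'.
    move=> g gu z /U'P[zX oz]; apply/U'P; split; first exact: sX.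
    exact: stable_orth.
  have [u [u' [xE uU u'U]]] := orth_decomp U x.
  have u'U' : u' \in U'.
    apply/U'P; split=> //; rewrite (_ : u' = x - u); last by rewrite xE addrC addKr.
    by rewrite rpredB // (subvP UX).
  (* Since [x = u + u'] is not orthogonal to [p], one of [u] and [u'] is not. By minimality the
     corresponding one of [U] and its complement [U'] in [X] is all of [X]. *)
  have [up|up] := eqVneq (dot u p) 0.
    left; have dU' : (\dim X <= \dim U')%N.
      apply: minX; split=> //; first exact: subv_trans XQ.
      by exists u' => //; move: xp; rewrite xE dotDl up add0r.
    have /eqP eU' : U' == X by rewrite eqEdim U'X.
    apply/eqP; rewrite -subv0; apply/subvP => z zU.
    have : z \in U' by rewrite eU' (subvP UX).
    by move=> /U'P[_ /(_ z zU)/dot_eq0->]; rewrite mem0v.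
  right; apply/eqP; rewrite eqEdim UX; apply: minX; split=> //.
    exact: subv_trans XQ.
  by exists u.
- exists (vsproj X x0); split.
  + apply: contra nx0 => /eqP/(congr1 vsval).
    by rewrite vsprojK // linear0 => /eqP.
  + move=> u uu; rewrite -[gl_act _ _]/(linfun (@sub_tact _ _ _ X u)).
    rewrite lfunE /= /sub_tact vsprojK //; congr (vsproj X _).
    rewrite (x0g _ 1) ?scale1r //; first exact: unitriangular_unit.
    by move=> v; rewrite conjC1 mul1r Plow //; apply: adjmx_upper.
  + move=> t nt; rewrite -[gl_act _ _]/(linfun (@sub_tact _ _ _ X (diag_mx t))).
    rewrite lfunE /= /sub_tact vsprojK // -linearZ; congr (vsproj X _).
    apply: x0g.
      by rewrite unitmxE det_diag unitfE; apply/prodf_neq0 => i _.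
    move=> v; have -> : adjmx (diag_mx t) = diag_mx (map_mx Num.conj t).
      by rewrite /adjmx tr_diag_mx map_diag_mx.
    rewrite Ptor; last by move=> i; rewrite mxE conjC_eq0.
    rewrite rmorph_prod; congr (_ * _); apply: eq_bigr => i _.
    by rewrite mxE; apply/esym; apply: fmorphXz.
- apply: sub_module_occurs => q qX; first by have /QP[] := subvP XQ q qX.
  by apply: injQ; apply: (subvP XQ).
Qed.

End CriterionMain.

(** * Weights of the coordinate ring are partitions of multiples of n *)

Section TorusWeights.
Variables (K : fieldType) (n : nat).

Lemma sym_act_diag d (t : 'rV[K]_n) (w : dhomog n K d) :
  sym_act (diag_mx t) w = \sum_(m <- msupp (w : {mpoly K[n]}))
    (\prod_i t 0 i ^+ m i) *: indhomog d ((w : {mpoly K[n]})@_m *: 'X_[m]).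
Proof.
apply/val_inj; rewrite /= raddf_sum /= /subst_act comp_mpolyE.
rewrite big_seq [RHS]big_seq; apply: eq_bigr => m mw.
rewrite -[mpoly_of_dhomog (indhomog _ _)]/(val (insubd _ _)) insubdK; last first.
  have /dhomogP hw := dhomog_is_dhomog w.
  by apply: rpredZ; rewrite dhomogX -(hw m mw) /=.
rewrite scalerA mulrC -scalerA; congr (_ *: _).
rewrite -mul_mpolyC rmorph_prod mpolyXE_id -big_split /=; apply: eq_bigr => i _.
rewrite tnth_mktuple /vec_poly (bigD1 i) //= big1 ?addr0; last first.
  by move=> j nji; rewrite !mxE (negPf nji) mulr0n scale0r.
by rewrite !mxE eqxx mulr1n -mul_mpolyC exprMn rmorphXn.
Qed.

Lemma meval_poly N (p : {mpoly K[N]}) (f : 'I_N -> {poly K}) :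
  exists q : {poly K}, forall x, q.[x] = p.@[fun i => (f i).[x]].
Proof.
exists (mmap (@polyC K) f p) => x.
rewrite mevalE /mmap horner_sum; apply: eq_bigr => m _.
rewrite hornerM hornerC /mmap1 horner_prod; congr (_ * _).
by apply: eq_bigr => i _; rewrite horner_exp.
Qed.

(** The embedding of the dual is transposed to an equivariant map [m] from the Chow variety to [M].
    Its values span [M], so the highest weight vector is a combination of them, and a coordinate
    form of [M] is applied to the weight identity. *)
Lemma S_Chow_torus (lam : 'rV[int]_n) : S_Chow K lam ->
  exists (a : K) (P : dhomog n K n -> K) (s : seq (K * dhomog n K n)),
  [/\ a != 0, polynomial_function P &
   forall t : 'rV_n, (forall i, t 0 i != 0) -> (\prod_i t 0 i ^ lam 0 i) * a =
     \sum_(x <- s) x.1 * P (sym_act (diag_mx t) x.2)].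
Proof.
case=> _ [M [_ [v [nv _ vt]] [Phi [regPhi linPhi actPhi injPhi]]]].
have linz z : scalar (fun phi : 'Hom(M, K^o) => Phi phi z).
  by move=> a phi psi; rewrite linPhi.
pose Pz z : {scalar 'Hom(M, K^o)} := HB.pack (fun phi : 'Hom(M, K^o) => Phi phi z)
   (GRing.isLinear.Build K 'Hom(M, K^o) K _ _ (linz z)).
pose b := vbasis {:M}.
pose e i : 'Hom(M, K^o) := linfun (coord b i : M -> K^o).
pose m z : M := \sum_i (Phi (e i) z) *: b`_i.
have mP (phi : 'Hom(M, K^o)) z : phi (m z) = Phi phi z.
  have {2}-> : phi = \sum_(i < \dim {:M}) (phi b`_i : K) *: e i.
    apply/lfunP => x; rewrite {1}(coord_vbasis (memvf x)) linear_sum sum_lfunE.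
    by apply: eq_bigr => i _; rewrite linearZ scale_lfunE lfunE /GRing.scale /= mulrC.
  rewrite -[RHS]/(Pz z _) !linear_sum; apply: eq_bigr => i _.
  by rewrite !linearZ /= mulrC.
have [||U UP] := @vspace_of_pred _ M (fun x => exists s : seq (K * Chow_pt K n),
    x = \sum_(y <- s) y.1 *: m y.2).
- by exists [::]; rewrite big_nil.
- move=> a x y [s ->] [s' ->]; exists ([seq (a * y.1, y.2) | y <- s] ++ s').
  rewrite big_cat big_map scaler_sumr /=; congr (_ + _).
  by apply: eq_bigr => z _; rewrite scalerA.
have mU z : m z \in U by apply/UP; exists [:: (1, z)]; rewrite big_seq1 scale1r.
(* A form [e i \o pi] vanishes on the span [U] of the values of [m], so its image under [Phi] is
   zero, and the form is zero by injectivity. *)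
have vU : v \in U.
  pose pi := daddv_pi U^C%VS U.
  have UC0 : (U^C :&: U = 0)%VS by rewrite capvC capv_compl.
  have piU x : x \in U -> pi x = 0.
    move=> xU; have := @daddv_pi_add _ _ _ _ x UC0.
    rewrite addvC addv_complf memvf => /(_ isT).
    rewrite [X in _ + X]daddv_pi_id ?capv_compl //.
    by move/(canRL (addrK _)); rewrite subrr.
  suff piv : pi v = 0.
    have := @daddv_pi_add _ _ _ _ v UC0.
    rewrite addvC addv_complf memvf => /(_ isT) <-.
    by rewrite -/pi piv add0r memv_pi.
  rewrite [pi v](coord_vbasis (memvf _)) big1 // => i _.
  suff -> : coord (vbasis fullv) i (pi v) = (e i \o pi)%VF v.
    suff -> : (e i \o pi)%VF = 0 by rewrite zero_lfunE scale0r.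
    apply: injPhi => z.
    by rewrite -!mP comp_lfunE piU // zero_lfunE linear0.
  by rewrite comp_lfunE lfunE.
have [s vE] := (UP v).1 vU.
have [i vi] : exists i, e i v != 0.
  apply/existsP; rewrite -negb_forall; apply: contra nv => /forallP h.
  rewrite [v](coord_vbasis (memvf _)) big1 // => i _.
  by move: (h i) => /eqP; rewrite lfunE /= => ->; rewrite scale0r.
have [P [pP PE]] := regPhi (e i).
exists (e i v), P, [seq (x.1, proj1_sig x.2) | x <- s]; split=> // t nt.
have tu : diag_mx t \in unitmx.
  by rewrite unitmxE det_diag unitfE; apply/prodf_neq0.
have tu' : invmx (diag_mx t) \in unitmx by rewrite unitmx_inv.
have := congr1 (e i) (vt t nt); rewrite linearZ => /esym etv.
rewrite [LHS]etv {1}vE !linear_sum big_map; apply: eq_bigr => x _.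
rewrite !linearZ /=; congr (_ * _).
rewrite -comp_lfunE mP.
have := actPhi _ (e i) tu' x.2; rewrite /dual_act /Chow_fun_act invmxK => ->.
by rewrite PE.
Qed.

End TorusWeights.

Section ChowWeights.
Variables (C : numClosedFieldType) (n : nat).

Lemma prim_root_exists m : (0 < m)%N -> exists z : C, m.-primitive_root z.
Proof.
move=> m_gt0; have [r rE] := closed_field_poly_normal ('X^m - 1 : {poly C}).
rewrite (monicP (monicXnsubC _ m_gt0)) scale1r in rE.
have ru : all m.-unity_root r.
  by apply/allP => z; rewrite -root_prod_XsubC -rE.
have := has_prim_root m_gt0 ru; case/(_ _ _)/hasP => [||z _ hz]; last by exists z.
  by rewrite -separable_prod_XsubC -rE cyclotomic.separable_Xn_sub_1 // pnatr_eq0 -lt0n.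
by rewrite -ltnS -(size_prod_XsubC r id) -rE size_XnsubC.
Qed.

Lemma poly_eventually0 (p : {poly C}) : (forall x, x != 0 -> p.[x] = 0) -> p = 0.
Proof.
move=> px; apply: (@roots_geq_poly_eq0 _ _ [seq i.+1%:R | i <- iota 0 (size p)]).
- by apply/allP => _ /mapP[i _ ->]; rewrite /root px // pnatr_eq0.
- rewrite map_inj_uniq ?iota_uniq // => i j /eqP.
  by rewrite eqr_nat eqSS => /eqP.
- by rewrite size_map size_iota.
Qed.

(** A scalar matrix [c] with [c ^+ n = 1] acts trivially on the [n]-th symmetric power, so
    [c ^ wsize lam = 1]. This is applied to a primitive [n]-th root of unity. *)
Lemma S_Chow_size (lam : 'rV[int]_n) : (0 < n)%N -> S_Chow C lam ->
  (wsize lam = 0 %[mod n])%Z.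
Proof.
move=> n_gt0 /S_Chow_torus[a [P [s [na _ aE]]]].
have [z pz] := prim_root_exists n_gt0.
have nz : z != 0.
  apply/eqP => z0; have := prim_expr_order pz.
  by rewrite z0 expr0n -[n == 0%N]negbK -lt0n n_gt0 => /esym/eqP; rewrite oner_eq0.
have scal (c : C) : c != 0 -> c ^+ n = 1 -> c ^ wsize lam * a =
    \sum_(x <- s) x.1 * P x.2.
  move=> nc cn; have := aE (const_mx c); have -> : c ^ wsize lam =
      \prod_i (const_mx c : 'rV_n) 0 i ^ lam 0 i.
    rewrite /wsize; elim/big_rec2: _ => [|i x y _ IH]; first by rewrite expr0z.
    by rewrite expfzDr // IH mxE.
  move->; last by move=> i; rewrite mxE.
  apply: eq_bigr => x _; congr (_ * P _).
  apply/val_inj; rewrite sym_act_diag /= raddf_sum /= [RHS]mpolyE.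
  rewrite big_seq [RHS]big_seq; apply: eq_bigr => m mw.
  have /dhomogP hw := dhomog_is_dhomog x.2.
  rewrite -[mpoly_of_dhomog (indhomog _ _)]/(val (insubd _ _)).
  rewrite insubdK; last by apply: rpredZ; rewrite dhomogX; apply/eqP/hw.
  rewrite (_ : \prod_i _ = c ^+ n) ?cn ?scale1r //.
  under eq_bigr => i _ do rewrite mxE.
  by rewrite prodrXr -mdegE -cn; congr (_ ^+ _); apply: hw.
have := scal 1 (oner_neq0 _) (expr1n _ _).
rewrite -(scal z nz (prim_expr_order pz)) exp1rz mul1r => /esym.
rewrite -{2}[a]mul1r => /(mulIf na) zl.
have : z ^ (wsize lam %% n)%Z = 1.
  rewrite (divz_eq (wsize lam) n) expfzDr // [X in z ^ X]mulrC -exprz_exp in zl.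
  by rewrite -exprnP (prim_expr_order pz) exp1rz mul1r in zl.
have n0 : n%:Z != 0 by rewrite eqz_nat -lt0n.
have := modz_ge0 (wsize lam) n0; have := ltz_mod (wsize lam) n0.
case: (wsize lam %% n)%Z => // k kn _ /eqP; rewrite -exprnP -(prim_order_dvd pz).
move=> nk; rewrite mod0z; congr Posz.
by apply/eqP; move: nk; rewrite /dvdn modn_small.
Qed.

(** Along the diagonal matrices with [c] in place [i] and [1] elsewhere, the functions in
    [S_Chow_torus] are polynomial in [c], whereas a negative weight would give a pole at [c = 0]. *)
Lemma S_Chow_ge0 (lam : 'rV[int]_n) i : S_Chow C lam -> 0 <= lam 0 i.
Proof.
move=> /S_Chow_torus[a [P [s [na [N [l [p PE]]] aE]]]].
pose t (c : C) : 'rV[C]_n := \row_j (if j == i then c else 1).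
have tE (c : C) (f : 'I_n -> C -> C) : (forall j, f j 1 = 1) ->
    \prod_j f j (t c 0 j) = f i c.
  move=> f1; rewrite (bigD1 i) //= mxE eqxx big1 ?mulr1 // => j /negPf nj.
  by rewrite mxE nj f1.
have [q qE] : exists q : {poly C}, forall c,
    q.[c] = \sum_(x <- s) x.1 * P (sym_act (diag_mx (t c)) x.2).
  elim: s {aE} => [|x s [q qE]].
    by exists 0 => c; rewrite big_nil horner0.
  have [r rE] := meval_poly p (fun k => \sum_(m <- msupp (x.2 : {mpoly C[n]}))
     l k (indhomog n ((x.2 : {mpoly C[n]})@_m *: 'X_[m])) *: 'X^(m i)).
  exists (x.1 *: r + q) => c; rewrite big_cons hornerD hornerZ qE rE PE.
  congr (_ * _ + _); apply: meval_eq => k.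
  rewrite sym_act_diag linear_sum horner_sum; apply: eq_bigr => m _.
  rewrite linearZ /= hornerZ hornerXn mulrC.
  by rewrite (tE c (fun j y => y ^+ m j)) // => j; rewrite expr1n.
have {}qE (c : C) : c != 0 -> q.[c] = c ^ lam 0 i * a.
  move=> nc; rewrite qE -aE; last by move=> j; rewrite mxE; case: ifP; rewrite ?oner_neq0.
  by rewrite (tE c (fun j y => y ^ lam 0 j)) // => j; rewrite exp1rz.
case: (lam 0 i) qE => // k qE.
have q0 : q * 'X^(k.+1) - a%:P = 0.
  apply: poly_eventually0 => c nc.
  rewrite hornerD hornerM hornerXn hornerN hornerC qE // NegzE.
  by rewrite -exprnN mulrAC mulVf ?expf_neq0 // mul1r subrr.
have := congr1 (fun r => r.[0]) q0.
rewrite hornerD hornerM hornerXn hornerN hornerC expr0n mulr0 add0r horner0.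
by move/eqP; rewrite oppr_eq0 (negPf na).
Qed.

Lemma S_Chow_partition (lam : 'rV[int]_n) : (0 < n)%N -> S_Chow C lam ->
  is_partition lam /\ (wsize lam = 0 %[mod n])%Z.
Proof.
move=> n_gt0 Sl; split; last exact: S_Chow_size.
by split=> [|i]; [case: Sl|apply: S_Chow_ge0].
Qed.

End ChowWeights.

(** * The saturated submonoid of partitions of multiples of [n] *)

Section Lattice.
Variable n : nat.

Lemma partition_submonoid : submonoid (fun lam : 'rV[int]_n =>
  is_partition lam /\ (wsize lam = 0 %[mod n])%Z).
Proof.
split.
  split; first by split=> [i j _|i]; rewrite !mxE.
  by rewrite /wsize big1 // => i _; rewrite mxE.
move=> x y [[dx px] sx] [[dy py] sy]; split.
  by split=> [i j ij|i]; rewrite !mxE ?addr_ge0 // lerD ?dx ?dy.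
rewrite /wsize; under eq_bigr do rewrite mxE.
by rewrite big_split /= -modzDm sx sy !mod0z.
Qed.

(** The inequalities are obtained by dividing those of [x *+ k] by [k]; the congruence does not
    survive that division and comes from writing [x] as a difference instead. *)
Lemma partition_saturated : saturated (fun lam : 'rV[int]_n =>
  is_partition lam /\ (wsize lam = 0 %[mod n])%Z).
Proof.
move=> x k [a [b [[_ sa] [_ sb] ->]]] k_gt0 [[dx px] _]; split.
  split=> [i j ij|i].
    by have := dx i j ij; rewrite !mulmxnE ler_pMn2r.
  by have := px i; rewrite mulmxnE pmulrn_lge0.
rewrite /wsize; under eq_bigr do rewrite !mxE.
by rewrite big_split /= sumrN -modzDm -modzNm sa sb modzNm modzDm subr0.
Qed.

End Lattice.

(** * Integrality over the functions of the product *)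

Section Integrality.
Variables (C : numClosedFieldType) (n k : nat).
Hypotheses (k_gt0 : (0 < k)%N) (n_gt0 : (0 < n)%N).
Local Notation tup := ('I_n -> 'cV[C]_n).
Local Notation M := (n * k)%N.
Implicit Types (v : tup) (F G : tup -> C) (c : 'I_n -> 'I_M -> nat) (e : 'I_n -> nat).

(** These are [n * k] linear forms in the first [k] coordinates, any [k] of which form a basis,
    because they are rows of a Vandermonde matrix with distinct nodes. *)
Definition vdm (s : 'I_M) : 'rV[C]_n := \row_(i < n) (if (i < k)%N then s.+1%:R ^+ i else 0).

Definition lform (s : 'I_M) v j : C := (vdm s *m v j) 0 0.

Definition mon c v : C := \prod_j \prod_s lform s v j ^+ c j s.

(** [d] is the degree of the coefficients as functions of the product; [e j] is the degree of the
    monomials in the forms of [v j], not counting the coefficients. *)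
Inductive homspan d e : (tup -> C) -> Prop :=
| homspan_mon G c F : homreg d G -> (forall j, \sum_s c j s = e j)%N ->
    (forall v, F v = G v * mon c v) -> homspan d e F
| homspan_add F G H : homspan d e F -> homspan d e G ->
    (forall v, H v = F v + G v) -> homspan d e H.

Lemma ord_M : 'I_M.
Proof. by apply: (@Ordinal _ 0); rewrite muln_gt0 n_gt0. Qed.

Lemma homspan0 d e : homspan d e (fun=> 0).
Proof.
apply: (@homspan_mon _ _ (fun=> 0) (fun j s => if s == ord_M then e j else 0)%N).
- exact: homreg0.
- by move=> j; rewrite -big_mkcond big_pred1_eq.
- by move=> v; rewrite mul0r.
Qed.

Lemma homspan_ext d e F G : homspan d e F -> F =1 G -> homspan d e G.
Proof.
by move=> hF FG; apply: homspan_add hF (homspan0 d e) _ => v; rewrite addr0 FG.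
Qed.

Lemma homspan_eq d e e' F : homspan d e F -> e =1 e' -> homspan d e' F.
Proof.
move=> hF ee; elim: hF => {F} [G c F hG ce FE|F G H _ hF _ hG HE].
  by apply: homspan_mon hG _ FE => j; rewrite ce ee.
exact: homspan_add hF hG HE.
Qed.

Lemma homspan_sum d e (I : Type) (r : seq I) (P : pred I) (F : I -> tup -> C) :
  (forall i, P i -> homspan d e (F i)) ->
  homspan d e (fun v => \sum_(i <- r | P i) F i v).
Proof.
move=> hF; elim: r => [|i r IH].
  by apply: homspan_ext (homspan0 d e) _ => v; rewrite big_nil.
case Pi: (P i).
  by apply: homspan_add (hF i Pi) IH _ => v; rewrite big_cons Pi.
by apply: homspan_ext IH _ => v; rewrite big_cons Pi.
Qed.

Lemma monD c c' v : mon (fun j s => c j s + c' j s)%N v = mon c v * mon c' v.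
Proof.
rewrite /mon -big_split; apply: eq_bigr => j _.
by rewrite -big_split; apply: eq_bigr => s _; rewrite exprD.
Qed.

Lemma eq_mon c c' v : (forall j s, c j s = c' j s) -> mon c v = mon c' v.
Proof.
by move=> h; apply: eq_bigr => j _; apply: eq_bigr => s _; rewrite h.
Qed.

Lemma homspanM d e F d' e' F' : homspan d e F -> homspan d' e' F' ->
  homspan (d + d') (fun j => e j + e' j)%N (fun v => F v * F' v).
Proof.
move=> hF; elim: hF F' => {F} [G c F hG ce FE|F G H _ IHF _ IHG HE] F' hF'.
  elim: hF' => {F'} [G' c' F' hG' ce' FE'|F' G' H' _ IHF' _ IHG' HE'].
    apply: (@homspan_mon _ _ _ (fun j s => c j s + c' j s)%N _ (homregM hG hG')).
      by move=> j; rewrite big_split /= ce ce'.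
    by move=> v; rewrite monD FE FE' mulrACA.
  by apply: homspan_add IHF' IHG' _ => v; rewrite HE' mulrDr.
by apply: homspan_add (IHF _ hF') (IHG _ hF') _ => v; rewrite HE mulrDl.
Qed.

Lemma homspan_reg d G : homreg d G -> homspan d (fun=> 0%N) G.
Proof.
move=> hG; apply: (@homspan_mon _ _ _ (fun _ _ => 0%N) _ hG).
  by move=> j; rewrite big1.
move=> v; rewrite /mon big1 ?mulr1 // => j _.
by rewrite big1.
Qed.

Lemma homspanZ d e a F : homspan d e F -> homspan d e (fun v => a * F v).
Proof. by move=> hF; apply: homspanM (homspan_reg (homreg_cst _ a)) hF. Qed.

Lemma homspan_prod (I : Type) (r : seq I) (e : I -> 'I_n -> nat)
    (F : I -> tup -> C) :
  (forall i, homspan 0 (e i) (F i)) ->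
  homspan 0 (fun j => \sum_(i <- r) e i j)%N (fun v => \prod_(i <- r) F i v).
Proof.
move=> hF; elim: r => [|i r IH].
  have h := homspan_reg (homreg_one C n).
  apply: homspan_ext (homspan_eq h _) _ => [j|v]; by rewrite big_nil.
apply: homspan_ext (homspan_eq (homspanM (hF i) IH) _) _ => [j|v];
  by rewrite big_cons.
Qed.

Lemma vdm_span (T : {set 'I_M}) : (k <= #|T|)%N ->
  forall r : 'rV[C]_n, (forall i : 'I_n, (k <= i)%N -> r 0 i = 0) ->
  exists (h : 'I_k -> 'I_M) (al : 'I_k -> C), (forall i, h i \in T) /\
    forall w : 'cV[C]_n, (r *m w) 0 0 = \sum_i al i * (vdm (h i) *m w) 0 0.
Proof.
move=> kT r r0; pose h (i : 'I_k) : 'I_M := enum_val (widen_ord kT i).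
have hI : injective h.
  by move=> i j /enum_val_inj/(congr1 val) /= /val_inj.
pose B := Vandermonde k (\row_(j < k) (h j).+1%:R : 'rV[C]_k).
have Bu : B \in unitmx.
  rewrite unitmxE det_Vandermonde unitfE.
  apply/prodf_neq0 => i _; apply/prodf_neq0 => j ij.
  rewrite !mxE subr_eq0 eqr_nat eqSS; apply: contraTneq ij.
  by move=> /val_inj/hI ->; rewrite ltnn.
pose r' : 'cV[C]_k := \col_l (if insub (val l) is Some i then r 0 i else 0).
exists h, (fun i => (invmx B *m r') i 0); split=> [i|w]; first exact: enum_valP.
rewrite mxE; under [RHS]eq_bigr do rewrite [X in _ * X]mxE mulr_sumr.
rewrite exchange_big /=; apply: eq_bigr => l _.
under eq_bigr do rewrite mulrA.
rewrite -mulr_suml; congr (_ * _).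
have [lk|kl] := ltnP l k; last first.
  by rewrite r0 // big1 // => i _; rewrite [X in _ * X]mxE ltnNge kl mulr0.
have -> : r 0 l = r' (Ordinal lk) 0 by rewrite mxE /= valK.
rewrite -{1}[r'](mulKVmx Bu) mxE; apply: eq_bigr => i _.
by rewrite mulrC; congr (_ * _); rewrite !mxE lk.
Qed.

Let delta (j : 'I_n) (s : 'I_M) (j' : 'I_n) (s' : 'I_M) : nat :=
  (j' == j) && (s' == s).

Lemma mon_delta j s v : mon (delta j s) v = lform s v j.
Proof.
rewrite /mon (bigD1 j) //= (bigD1 s) //= /delta !eqxx expr1 big1 => [|s' /negPf ns].
  rewrite mulr1 big1 ?mulr1 // => j' /negPf nj; rewrite big1 // => s' _.
  by rewrite nj.
by rewrite ns.
Qed.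

Lemma sum_delta j s j' : (\sum_s' delta j s j' s' = (j' == j))%N.
Proof.
rewrite (bigD1 s) //= /delta eqxx andbT big1 ?addn0 // => s' /negPf->.
by rewrite andbF.
Qed.

Lemma homspan_lform s j : homspan 0 (fun j' => j' == j : nat) (fun v => lform s v j).
Proof.
apply: (@homspan_mon _ _ (fun=> 1) (delta j s)); first exact: homreg_one.
  by move=> j'; rewrite sum_delta.
by move=> v; rewrite mon_delta mul1r.
Qed.

Lemma homspan_coord (i j : 'I_n) : (i < k)%N ->
  homspan 0 (fun j' => j' == j : nat) (fun v => v j i 0).
Proof.
move=> ik; have kT : (k <= #|[set: 'I_M]|)%N by rewrite cardsT card_ord leq_pmull.
have r0 (l : 'I_n) : (k <= l)%N -> (delta_mx 0 i : 'rV[C]_n) 0 l = 0.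
  by rewrite mxE eqxx /=; case: eqP => // ->; rewrite leqNgt ik.
have [h [al [_ hE]]] := vdm_span kT r0.
have h' := homspan_sum (index_enum 'I_k) (P := predT)
  (fun a _ => homspanZ (al a) (homspan_lform (h a) j)).
apply: homspan_ext h' _ => v; rewrite -hE mxE (bigD1 i) //= mxE !eqxx mul1r.
by rewrite big1 ?addr0 // => l /negPf nl; rewrite mxE nl andbF mul0r.
Qed.

(* If every linear form divides the monomial in all the vectors then so does
   its evaluation at [v_1 ... v_n]. Otherwise some vector misses [k] of the
   forms, which span, and a repeated factor can be replaced by these. *)
Lemma mon_reduce c : (forall j, M < \sum_s c j s)%N ->
  homspan 1 (fun j => (\sum_s c j s).-1) (mon c).
Proof.
(* Induction on the number of vanishing exponents. *)
pose mu c := #|[set x : 'I_n * 'I_M | c x.1 x.2 == 0%N]|.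
have [m] := ubnP (mu c); elim: m c => // m IH c mc cM.
case: (boolP [exists s, forall j, (0 < c j s)%N]) => [/existsP[s /forallP cs]|].
  pose c' j t := (c j t - (t == s))%N.
  have cE j t : c j t = (c' j t + (t == s))%N.
    by rewrite /c' subnK //; case: eqP => // ->.
  apply: (@homspan_mon _ _ (ev (vdm s)) c'); first exact: homreg_ev.
    move=> j; under [in RHS]eq_bigr do rewrite cE.
    rewrite big_split /= [X in (_ + X)%N](bigD1 s) //= eqxx.
    by rewrite [X in (_ + (_ + X))%N]big1 ?addn0 ?addn1 // => t /negPf->.
  move=> v; rewrite mulrC (eq_mon (c' := fun j t => (c' j t + (t == s))%N)) // monD.
  congr (_ * _); apply: eq_bigr => j _.
  rewrite (bigD1 s) //= eqxx expr1 big1 ?mulr1 // => t /negPf->.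
  by rewrite expr0.
rewrite negb_exists => /forallP ncs.
(* Each of the [n * k] forms has exponent zero for some vector, so some vector has at least [k] zero
   exponents. *)
have [j kj] : exists j, (k <= #|[set s | c j s == 0%N]|)%N.
  apply/existsP; apply: contraT; rewrite negb_exists => /forallP lt.
  have : (M <= \sum_(j < n) #|[set s | c j s == 0%N]|)%N.
    under eq_bigr do rewrite -sum1_card big_mkcond.
    rewrite exchange_big /=.
    rewrite [X in (X <= _)%N](_ : M = \sum_(s < M) 1)%N; last by rewrite sum1_card card_ord.
    apply: leq_sum => s _.
    have := ncs s; rewrite negb_forall => /existsP[j]; rewrite -eqn0Ngt => cj.
    by rewrite (bigD1 j) //= inE cj leq_addr.
  rewrite leqNgt => /negP[]; apply: leq_ltn_trans (_ : n * k.-1 < _)%N.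
    have -> : (n * k.-1 = \sum_(j < n) k.-1)%N by rewrite sum_nat_const card_ord.
    apply: leq_sum => j _.
    by rewrite -ltnS prednK // ltnNge lt.
  by rewrite ltn_pmul2l // prednK.
(* The total exponent exceeds the number of forms. An exponent that is at least [2] stays positive
   when lowered, so the replacement creates no new zero and removes one. *)
have [s cjs] : exists s, (1 < c j s)%N.
  apply/existsP; apply: contraT; rewrite negb_exists => /forallP le.
  have := cM j; rewrite ltnNge => /negP[].
  rewrite [X in (_ <= X)%N](_ : M = \sum_(s < M) 1)%N; last by rewrite sum1_card card_ord.
  apply: leq_sum => s _.
  by rewrite leqNgt le.
have vdm0 (i : 'I_n) : (k <= i)%N -> vdm s 0 i = 0 by rewrite mxE ltnNge => ->.
have [h [al [hT hE]]] := vdm_span kj vdm0.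
pose c0 j' s' := (c j' s' - delta j s j' s')%N.
have cE j' s' : c j' s' = (c0 j' s' + delta j s j' s')%N.
  rewrite /c0 subnK // /delta; case: eqP => // ->; case: eqP => // -> /=.
  exact: ltnW.
pose ci i j' s' := (c0 j' s' + delta j (h i) j' s')%N.
have sum_ci i j' : (\sum_s' ci i j' s' = \sum_s' c j' s')%N.
  under [RHS]eq_bigr do rewrite cE.
  by rewrite !big_split /= !sum_delta.
have hci i : homspan 1 (fun j => (\sum_s c j s).-1) (mon (ci i)).
  apply: (@homspan_eq _ (fun j => (\sum_s ci i j s).-1)); last first.
    by move=> j'; rewrite sum_ci.
  apply: IH => [|j']; last by rewrite sum_ci.
  rewrite -ltnS; apply: leq_trans mc; rewrite ltnS; apply: proper_card.
  apply/properP; split.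
    apply/subsetP => -[j' s']; rewrite !inE /= cE /ci addn_eq0 => /andP[/eqP c00 _].
    rewrite c00 add0n eqb0; apply/negP => /andP[/eqP ej /eqP es].
    by move: c00; rewrite ej es /c0 /delta !eqxx subn1; case: (c j s) cjs => [|[]].
  exists (j, h i); first by have := hT i; rewrite !inE.
  by rewrite !inE /ci /delta /= !eqxx addn1.
have h' := homspan_sum (index_enum 'I_k) (P := predT)
  (fun i _ => homspanZ (al i) (hci i)).
apply: homspan_ext h' _.
move=> v; rewrite (eq_mon (c' := fun j' s' => (c0 j' s' + delta j s j' s')%N)) //.
rewrite monD mon_delta /lform hE mulr_sumr; apply: eq_bigr => i _.
by rewrite monD mon_delta mulrCA.
Qed.

Lemma homspan_reduce d e F : (forall j, M < e j)%N -> homspan d e F ->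
  homspan d.+1 (fun j => (e j).-1) F.
Proof.
move=> eM; elim=> {F} [G c F hG ce FE|F G H _ IHF _ IHG HE]; last first.
  exact: homspan_add IHF IHG HE.
have cM j : (M < \sum_s c j s)%N by rewrite ce.
have := homspanM (homspan_reg hG) (mon_reduce cM).
rewrite addn1 => h; apply: homspan_ext (homspan_eq h _) _ => [j|v].
  by rewrite /= ce.
by rewrite FE.
Qed.

Lemma homspan_reduce_iter d r F : homspan d (fun=> M + r)%N F ->
  homspan (d + r) (fun=> M) F.
Proof.
elim: r d => [|r IH] d hF; first by rewrite addn0; apply: homspan_eq hF _ => j; rewrite addn0.
rewrite addnS -addSn; apply: IH.
apply: (@homspan_eq _ (fun=> (M + r.+1).-1)%N); last by move=> j; rewrite addnS.
by apply: homspan_reduce hF => j; rewrite addnS ltnS leq_addr.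
Qed.

Local Notation Ix := {ffun 'I_n * 'I_M -> 'I_M.+1}.

(** Exponents of a monomial of degree [M] in each vector are at most [M], so these monomials form a
    finite family; indices of any other degree get the function [0]. *)
Definition base (x : Ix) v : C :=
  if [forall j, \sum_s x (j, s) == M :> nat]%N
  then mon (fun j s => x (j, s)) v else 0.

Lemma homspan_base d F : homspan d (fun=> M) F -> exists A : Ix -> tup -> C,
  (forall x, homreg d (A x)) /\ (forall v, F v = \sum_x A x v * base x v).
Proof.
elim=> {F} [G c F hG ce FE|F G H _ [A [hA AE]] _ [B [hB BE]] HE]; last first.
  exists (fun x v => A x v + B x v); split=> [x|v]; first exact: homregD.
  by rewrite HE AE BE -big_split; apply: eq_bigr => x _; rewrite mulrDl.
pose x : Ix := [ffun y => inord (c y.1 y.2)].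
have xE j s : x (j, s) = c j s :> nat.
  rewrite ffunE inordK //= ltnS; apply: leq_trans (_ : \sum_t c j t <= _)%N.
    by rewrite (bigD1 s) //= leq_addr.
  by rewrite ce.
exists (fun y => if y == x then G else fun=> 0); split=> [y|v].
  by case: eqP => // _; apply: homreg0.
rewrite (bigD1 x) //= eqxx big1 ?addr0 => [|y /negPf->]; last by rewrite mul0r.
rewrite FE /base ifT; last first.
  by apply/forallP => j; under eq_bigr do rewrite xE; rewrite ce.
by congr (_ * _); apply: eq_mon => j s; rewrite xE.
Qed.

Lemma base_homspan x : homspan 0 (fun=> M) (base x).
Proof.
have [h|/negPf h] := boolP [forall j, \sum_s x (j, s) == M :> nat]%N; last first.
  by apply: homspan_ext (homspan0 _ _) _ => v; rewrite /base h.
apply: (@homspan_mon _ _ (fun=> 1) (fun j s => nat_of_ord (x (j, s)))).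
- exact: homreg_one.
- by move=> j; apply/eqP/(forallP h).
- by move=> v; rewrite mul1r /base h.
Qed.

(** If [F v] is nonzero, every [v j] is nonzero on some form; the [M]-th powers of these forms
    multiply to a member of the family. *)
Lemma base_neq0 d e F v : homspan d e F -> (forall j, 0 < e j)%N -> F v != 0 ->
  exists x, base x v != 0.
Proof.
move=> hF e_gt0 Fv.
have [c ce cv] : exists2 c, (forall j, \sum_s c j s = e j)%N & mon c v != 0.
  elim: hF Fv => {F} [G c F _ ce ->|F G H _ IHF _ IHG ->].
    by rewrite mulf_eq0 negb_or => /andP[_ cv]; exists c.
  have [F0|/IHF//] := eqVneq (F v) 0.
  by rewrite F0 add0r => /IHG.
have /fin_all_exists[s sv] j : exists s, lform s v j != 0.
  have [s cs] : exists s, (0 < c j s)%N.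
    apply/existsP; apply: contraTT (e_gt0 j); rewrite negb_exists => /forallP h.
    rewrite -ce big1 // => s _; apply/eqP.
    by have := h s; rewrite -eqn0Ngt.
  exists s; move: cv => /prodf_neq0/(_ j isT)/prodf_neq0/(_ s isT).
  by rewrite expf_eq0 cs.
exists [ffun y => if y.2 == s y.1 then ord_max else ord0].
rewrite /base ifT.
  apply/prodf_neq0 => j _; apply/prodf_neq0 => t _; rewrite ffunE /=.
  by have [->|_] := eqVneq t (s j); [apply: expf_neq0|rewrite expr0 oner_neq0].
apply/forallP => j; rewrite (bigD1 (s j)) //= ffunE eqxx big1 ?addn0 //.
by move=> t /negPf; rewrite ffunE /= => ->.
Qed.

Lemma char_poly_homreg d D (A : tup -> 'M[C]_D) :
  (forall i j, homreg d (fun v => A v i j)) ->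
  forall i, (i <= D)%N -> homreg (d * (D - i)) (fun v => (char_poly (A v))`_i).
Proof.
move=> hA.
(* Homogeneity of total degree [m] in the variable and the matrix entries, where an entry has degree
   [d] on the symmetric power. This is stable under products. *)
pose gp m (F : tup -> {poly C}) := (forall i : nat, (i <= m)%N -> homreg (d * (m - i)) (fun v => (F v)`_i))
  /\ (forall (i : nat) v, (m < i)%N -> (F v)`_i = 0).
have gpM m m' (F F' : tup -> {poly C}) : gp m F -> gp m' F' -> gp (m + m')%N (fun v => F v * F' v).
  case=> hF F0 [hF' F'0]; split=> [i im|i v mi].
    have h : homreg (d * (m + m' - i)) (fun v => \sum_(j < i.+1) (F v)`_j * (F' v)`_(i - j)).
      apply: homreg_sum => j _.
      have [jm|mj] := leqP j m; last first.
        by apply: homreg_ext (homreg0 _ _ _) _ => v; rewrite F0 ?mul0r.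
      have [jm'|mj'] := leqP (i - j) m'; last first.
        by apply: homreg_ext (homreg0 _ _ _) _ => v; rewrite F'0 ?mulr0.
      have := homregM (hF _ jm) (hF' _ jm'); rewrite -mulnDr.
      suff -> : (m - j + (m' - (i - j)) = m + m' - i)%N by [].
      have ji : (j <= i)%N by rewrite -ltnS.
      rewrite addnBA // addnC addnBA // -subnDA subnKC //.
      by rewrite addnC.
    by apply: homreg_ext h _ => v; rewrite coefM.
  rewrite coefM big1 // => j _.
  have [jm|mj] := leqP j m; last by rewrite F0 ?mul0r.
  rewrite F'0 ?mulr0 // -(ltn_add2r j) subnK; last by rewrite -ltnS.
  by apply: leq_ltn_trans mi; rewrite addnC leq_add2r.
have gp_prod (r : seq 'I_D) (F : 'I_D -> tup -> {poly C}) : (forall i, gp 1 (F i)) ->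
    gp (size r) (fun v => \prod_(i <- r) F i v).
  move=> hF; elim: r => [|a r IH].
    split=> [i|i v i0]; last by rewrite big_nil coef1 eqn0Ngt i0.
    rewrite leqn0 => /eqP->; rewrite subnn muln0.
    by apply: homreg_ext (homreg_one _ _) _ => v; rewrite big_nil coef1.
  have [h1 h2] := gpM _ _ _ _ (hF a) IH; split=> [i ir|i v ir].
    by apply: homreg_ext (h1 i ir) _ => v; rewrite big_cons.
  by rewrite big_cons h2.
move=> i iD; rewrite /char_poly /determinant.
have h : homreg (d * (D - i)) (fun v =>
    \sum_(s : {perm 'I_D}) (-1) ^+ (odd_perm s) * (\prod_j char_poly_mx (A v) j (s j))`_i).
  apply: homreg_sum => s _; apply: homregZ.
  have := gp_prod (index_enum 'I_D) (fun i v => char_poly_mx (A v) i (s i)).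
  rewrite /index_enum -enumT size_enum_ord => hgp.
  have [h _] : gp D (fun v => \prod_(i <- enum 'I_D) char_poly_mx (A v) i (s i)).
    apply: hgp => a; split=> [j|j v j1]; last first.
      rewrite !mxE coefB coefMn coefX coefC.
      by case: j j1 => [|[|j]] //; rewrite mul0rn subr0.
    case: j => [_|[_|//]]; rewrite ?subn0 ?subnn ?muln1 ?muln0.
      apply: homreg_ext (homregZ (-1) (hA a (s a))) _ => v.
      by rewrite !mxE coefB coefMn coefX coefC /= mul0rn sub0r mulN1r.
    apply: homreg_ext (homreg_cst _ ((a == s a)%:R)) _ => v.
    by rewrite !mxE coefB coefMn coefX coefC /= subr0.
  by apply: homreg_ext (h i iD) _ => v; rewrite enumT.
apply: homreg_ext h _ => v; rewrite coef_sum; apply: eq_bigr => s _.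
by case: (odd_perm s); rewrite ?expr1 ?expr0 ?mulN1r ?mul1r ?coefN.
Qed.

(** The determinant trick. Multiplying a member of [base] by [F] gives degree [M + d] in each
    vector, and [d] reductions bring it back to [M] with coefficients of degree [d], so [F v] is an
    eigenvalue of a matrix of such coefficients. *)
Lemma homspan_integral d F : (0 < d)%N -> homspan 0 (fun=> d) F ->
  exists (D : nat) (P : nat -> tup -> C),
  [/\ forall i, (i <= D)%N -> homreg (d * i) (P i), forall v, P 0 v = 1
    & forall v, \sum_(i < D.+1) P i v * F v ^+ (D.+1 - i) = 0].
Proof.
move=> d_gt0 hF.
have /fin_all_exists[A hA] (x : Ix) : exists A : Ix -> tup -> C,
    (forall y, homreg d (A y)) /\
    (forall v, F v * base x v = \sum_y A y v * base y v).
  apply: homspan_base; have := homspanM (base_homspan x) hF => h.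
  have := homspan_reduce_iter h; rewrite addnn add0n.
  by move/homspan_ext; apply=> v; rewrite mulrC.
pose D := #|Ix|.
pose B v : 'M[C]_D := \matrix_(i, j) A (enum_val j) (enum_val i) v.
exists D, (fun i v => (char_poly (B v))`_(D - i)); split.
- move=> i iD; have := @char_poly_homreg d D B _ (D - i)%N (leq_subr _ _).
  rewrite subKn //; apply=> a b.
  by apply: homreg_ext (proj1 (hA (enum_val b)) (enum_val a)) _ => v; rewrite mxE.
- move=> v; rewrite subn0; have := char_poly_monic (B v).
  by rewrite monicE lead_coefE size_char_poly => /eqP.
(* The relation is the characteristic equation times [F]. The extra factor covers the zeros of [F],
   where the candidate eigenvector may vanish. *)
move=> v; have [F0|nF] := eqVneq (F v) 0.
  rewrite F0 big1 // => i _; rewrite expr0n subn_eq0 leqNgt ltn_ord.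
  by rewrite mulr0.
have : root (char_poly (B v)) (F v).
  rewrite -eigenvalue_root_char; apply/eigenvalueP.
  exists (\row_i base (enum_val i) v).
    apply/rowP => j; rewrite !mxE (proj2 (hA _)).
    rewrite (reindex (@enum_val Ix predT)) /=; last first.
      by apply: (enum_val_bij_in (x0 := [ffun=> ord0])).
    by apply: eq_bigr => i _; rewrite !mxE mulrC.
  have [|x bx] := base_neq0 hF _ nF; first by [].
  apply: contraNneq bx => /rowP/(_ (enum_rank x)).
  by rewrite !mxE enum_rankK => ->.
rewrite /root horner_coef size_char_poly => /eqP rE.
transitivity ((\sum_(i < D.+1) (char_poly (B v))`_i * F v ^+ i) * F v); last first.
  by rewrite rE mul0r.
rewrite mulr_suml (reindex_inj rev_ord_inj) /=; apply: eq_bigr => i _.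
have iD : (i <= D)%N by rewrite -ltnS.
by rewrite !subSS subSn ?leq_subr // !subKn // -mulrA -exprSr.
Qed.

End Integrality.

(** * Multiples of the fundamental weights *)

Lemma gtupM (K : fieldType) n (g h : 'M[K]_n) v :
  gtup g (gtup h v) = gtup (g *m h) v.
Proof. by apply: functional_extensionality => j; rewrite /gtup mulmxA. Qed.

Lemma gtup1 (K : fieldType) n (v : 'I_n -> 'cV[K]_n) : gtup 1%:M v = v.
Proof. by apply: functional_extensionality => j; rewrite /gtup mul1mx. Qed.

(** * Averaging over a group of matrices closed under adjoints *)

Section Averaging.
Variables (C : numClosedFieldType) (n : nat) (Gam : 'M[C]_n -> Prop).
Local Notation tup := ('I_n -> 'cV[C]_n).
Hypotheses (Gam1 : Gam 1%:M) (GamM : forall g h, Gam g -> Gam h -> Gam (g *m h)).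
Hypothesis GamA : forall g, Gam g -> Gam (adjmx g).

Definition average (s : seq (C * 'M[C]_n)) (P : tup -> C) (v : tup) : C :=
  \sum_(x <- s) x.1 * P (gtup x.2 v).

(* The orthogonal complement of the span of the [g p - p] consists of
   invariants, so the component of [p] there is an average of its orbit. *)
Lemma average_invariant N (P : tup -> C) : homreg N P ->
  exists s, [/\ forall x, x \in s -> Gam x.2, \sum_(x <- s) x.1 = 1 &
    forall g v, Gam g -> average s P (gtup g v) = average s P v].
Proof.
move=> /homreg_tfun[p pE].
have [||D DP] := @vspace_of_pred _ {ffun {ffun 'I_n * 'I_N -> 'I_n} -> C^o} (fun x =>
  exists s : seq (C * 'M[C]_n), (forall y, y \in s -> Gam y.2) /\
    x = \sum_(y <- s) y.1 *: (tact y.2 p - p)).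
- by exists [::]; rewrite big_nil.
- move=> a x y [s [Gs ->]] [s' [Gs' ->]].
  exists ([seq (a * z.1, z.2) | z <- s] ++ s'); split.
    by move=> z; rewrite mem_cat => /orP[/mapP[w /Gs h ->]|/Gs'].
  rewrite big_cat big_map scaler_sumr /=; congr (_ + _).
  by apply: eq_bigr => z _; rewrite scalerA.
have gD g : Gam g -> tact g p - p \in D.
  move=> Gg; apply/DP; exists [:: (1, g)]; rewrite big_seq1 scale1r.
  by split=> // y; rewrite inE => /eqP->.
have sD g x : Gam g -> x \in D -> tact g x \in D.
  move=> Gg /DP[s [Gs ->]]; rewrite linear_sum big_seq rpred_sum // => y ys.
  rewrite linearZ rpredZ //= linearB /= -tactM.
  have -> : tact (g *m y.2) p - tact g p =
      (tact (g *m y.2) p - p) - (tact g p - p) by rewrite opprB addrA subrK.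
  by rewrite rpredB // gD //; apply: GamM => //; apply: Gs.
have [d [e [ep dD eD]]] := orth_decomp D p.
have eG g : Gam g -> tact g e = e.
  move=> Gg; apply/eqP; rewrite -subr_eq0; apply/eqP.
  have dD' : tact g e - e \in D.
    have -> : tact g e - e = (tact g p - p) - (tact g d - d).
      by rewrite ep linearD /= opprD addrACA [RHS]addrC addKr.
    by rewrite rpredB ?gD // rpredB // sD.
  have ort u : u \in D -> dot u (tact g e - e) = 0; last exact/dot_eq0/ort.
  move=> uD; rewrite linearB /= eD // subr0 -[g]adjmxK -dot_tact eD //.
  by apply: sD => //; apply: GamA.
have [s [Gs dE]] := (DP d).1 dD.
(* This rewrites [e = p - d] as a combination of translates of [p]; the weight of the identity makes
   the total weight [1]. *)
exists ((1 + \sum_(y <- s) y.1^*, 1%:M) :: [seq (- y.1^*, adjmx y.2) | y <- s]).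
have aE v : average ((1 + \sum_(y <- s) y.1^*, 1%:M) ::
    [seq (- y.1^*, adjmx y.2) | y <- s]) P v = tfun e v.
  have -> : e = p - d by rewrite ep addrC addKr.
  rewrite /average big_cons big_map /= gtup1 mulrDl mul1r.
  rewrite /tfun dotBl -!/(tfun _ v) -pE -addrA; congr (_ + _).
  rewrite dE mulr_suml -big_split /= /tfun.
  elim: s {Gs dE} => [|y s IH].
    by rewrite !big_nil -dot_conj linear0 conjC0 oppr0.
  rewrite !big_cons dotDl opprD IH; congr (_ + _).
  rewrite dotZl dotBl -!/(tfun _ v) tfun_tact -!pE.
  by rewrite mulrBr opprB mulNr.
split.
- move=> x; rewrite inE => /orP[/eqP->//|/mapP[y ys ->]].
  exact/GamA/Gs.
- by rewrite big_cons big_map /= sumrN addrK.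
- move=> g v Gg; rewrite !aE -[in LHS](adjmxK g) -tfun_tact eG //.
  exact: GamA.
Qed.

Lemma homreg_average N s P : homreg N P -> homreg N (average s P).
Proof.
move=> hP; apply: homreg_sum => x _; apply: homregZ; exact: homreg_gtup.
Qed.

(** The coefficients are averaged one index at a time. Since [F] is invariant, averaging all
    coefficients keeps the relation; as the total weight is [1], it fixes the leading [1] and the
    coefficients already invariant. *)
Lemma invariant_relation D d (F : tup -> C) (P : nat -> tup -> C) :
  (forall g v, Gam g -> F (gtup g v) = F v) ->
  (forall i, (i <= D)%N -> homreg (d * i) (P i)) -> (forall v, P 0 v = 1) ->
  (forall v, \sum_(i < D.+1) P i v * F v ^+ (D.+1 - i) = 0) ->
  exists Q : nat -> tup -> C,
  [/\ forall i, (i <= D)%N -> homreg (d * i) (Q i), forall v, Q 0 v = 1,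
    forall i, (i <= D)%N -> forall g v, Gam g -> Q i (gtup g v) = Q i v
    & forall v, \sum_(i < D.+1) Q i v * F v ^+ (D.+1 - i) = 0].
Proof.
move=> FG hP P0 PR.
suff H r : (r <= D.+1)%N -> exists Q : nat -> tup -> C,
  [/\ forall i, (i <= D)%N -> homreg (d * i) (Q i), forall v, Q 0 v = 1,
    forall i, (i < r)%N -> forall g v, Gam g -> Q i (gtup g v) = Q i v
    & forall v, \sum_(i < D.+1) Q i v * F v ^+ (D.+1 - i) = 0].
  by have [Q [Q1 Q2 Q3 Q4]] := H _ (leqnn D.+1); exists Q; split.
elim: r => [_|r IH rD]; first by exists P; split.
have [Q [hQ Q0 QG QR]] := IH (ltnW rD).
have [s [Gs s1 sG]] := average_invariant (hQ r rD).
exists (fun i => average s (Q i)); split.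
- by move=> i iD; apply: homreg_average; apply: hQ.
- by move=> v; rewrite /average -[RHS]s1; apply: eq_bigr => x _; rewrite Q0 mulr1.
- move=> i; rewrite ltnS leq_eqVlt => /orP[/eqP->//|ir] g v Gg.
  have QE w : average s (Q i) w = Q i w.
    rewrite /average big_seq -[RHS]mul1r -s1 mulr_suml [RHS]big_seq.
    by apply: eq_bigr => x xs; rewrite QG //; apply: Gs.
  by rewrite !QE QG.
- move=> v; under eq_bigr do rewrite mulr_suml.
  rewrite exchange_big /= big_seq big1 // => x xs.
  transitivity (x.1 * \sum_(i < D.+1) Q i (gtup x.2 v) * F (gtup x.2 v) ^+ (D.+1 - i)); last first.
    by rewrite QR mulr0.
  rewrite mulr_sumr.
  by apply: eq_bigr => i _; rewrite mulrA FG //; apply: Gs.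
Qed.

End Averaging.

Section FundamentalWeights.
Variables (C : numClosedFieldType) (n k : nat).
Hypotheses (k_gt0 : (0 < k)%N) (kn : (k <= n)%N).
Local Notation tup := ('I_n -> 'cV[C]_n).

Let n_gt0 : (0 < n)%N := leq_trans k_gt0 kn.

(* SL_k acting on the first k coordinates *)
Definition slk (g : 'M[C]_n) : Prop := \det g = 1 /\
  forall i j : 'I_n, (k <= i)%N || (k <= j)%N -> g i j = (i == j)%:R.

Lemma slk1 : slk 1%:M.
Proof. by split=> [|i j _]; rewrite ?det1 // mxE. Qed.

Lemma slkM g h : slk g -> slk h -> slk (g *m h).
Proof.
move=> [dg Eg] [dh Eh]; split=> [|i j]; first by rewrite det_mulmx dg dh mulr1.
case/orP=> kij; rewrite mxE.
  rewrite (bigD1 i) //= Eg ?kij // eqxx mul1r Eh ?kij // big1 ?addr0 // => l nl.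
  by rewrite Eg ?kij // eq_sym (negPf nl) mul0r.
rewrite (bigD1 j) //= Eh ?kij ?orbT // eqxx mulr1 Eg ?kij ?orbT // big1 ?addr0 // => l nl.
by rewrite Eh ?kij ?orbT // (negPf nl) mulr0.
Qed.

Lemma slkA g : slk g -> slk (adjmx g).
Proof.
move=> [dg Eg]; split=> [|i j kij]; first by rewrite det_map_mx det_tr dg rmorph1.
by rewrite !mxE Eg 1?orbC // eq_sym rmorph_nat.
Qed.

(* The determinant is the k x k minor of the first [k] rows of
   [v (s 0), ..., v (s (k - 1))]. *)
Definition detk_mx (s : {perm 'I_n}) (v : tup) : 'M[C]_n := \matrix_(i, j)
  (if (j < k)%N then (if (i < k)%N then v (s j) i 0 else 0) else (i == j)%:R).

(** The product over all permutations has the same degree in every vector, as [homspan_integral]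
    requires. *)
Definition detk_prod (v : tup) : C := \prod_(s : {perm 'I_n}) \det (detk_mx s v).

Lemma detk_prod_slk g v : slk g -> detk_prod (gtup g v) = detk_prod v.
Proof.
move=> [dg Eg]; apply: eq_bigr => s _.
suff -> : detk_mx s (gtup g v) = g *m detk_mx s v by rewrite det_mulmx dg mul1r.
apply/matrixP => i j; rewrite !mxE.
have [jk|kj] := ltnP j k; last first.
  rewrite (bigD1 j) //= mxE ltnNge kj /= eqxx mulr1 Eg ?kj ?orbT //.
  by rewrite big1 ?addr0 // => l nl; rewrite mxE ltnNge kj (negPf nl) mulr0.
have [ik|ki] := ltnP i k; last first.
  rewrite big1 // => l _; rewrite mxE jk.
  have [lk|kl] := ltnP l k; last by rewrite mulr0.
  rewrite Eg ?ki //; case: eqP => [il|]; last by rewrite mul0r.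
  by move: ki; rewrite il leqNgt lk.
apply: eq_bigr => l _; rewrite mxE jk.
have [//|kl] := ltnP l k.
rewrite Eg ?kl ?orbT //; case: eqP => [il|]; last by rewrite !mul0r.
by move: kl; rewrite -il leqNgt ik.
Qed.

(** After this singular projection, a lower unitriangular or diagonal matrix acts only through its
    upper left [k] by [k] block. *)
Definition projk : 'M[C]_n := diag_mx (\row_i (i < k)%:R).

Lemma gtup_projk (v : tup) j i : gtup projk v j i 0 = (i < k)%:R * v j i 0.
Proof. by rewrite /gtup mul_diag_mx !mxE. Qed.

Lemma detk_prod_projk v : detk_prod (gtup projk v) = detk_prod v.
Proof.
apply: eq_bigr => s _; congr (\det _); apply/matrixP => i j; rewrite mxE [RHS]mxE gtup_projk.
by case: (j < k)%N; case: (i < k)%N; rewrite ?mul1r.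
Qed.

Lemma detk_prod_span : exists2 d, (0 < d)%N & homspan k 0 (fun=> d) detk_prod.
Proof.
pose e (s : {perm 'I_n}) (j j' : 'I_n) : nat := (j < k)%N && (j' == s j).
pose d (j' : 'I_n) := (\sum_(s : {perm 'I_n}) \sum_j e s j j')%N.
pose o : 'I_n := Ordinal n_gt0.
have dE j' : d j' = d o.
  rewrite /d (reindex_inj (mulIg (tperm j' o))) /=; apply: eq_bigr => s _.
  apply: eq_bigr => j _; rewrite /e permM.
  by rewrite -[in LHS](inj_eq (@perm_inj _ (tperm j' o))) tpermL tpermK.
exists (d o).
  by rewrite /d (bigD1 1%g) //= (bigD1 o) //= /e perm1 eqxx andbT k_gt0.
have hdet s : homspan k 0 (fun j' => \sum_j e s j j')%N (fun v => \det (detk_mx s v)).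
  have h : homspan k 0 (fun j' => \sum_j e s j j')%N (fun v =>
      \sum_(t : {perm 'I_n}) (-1) ^+ (odd_perm t) * \prod_j detk_mx s v (t j) j).
    apply: homspan_sum => // t _; apply: homspanZ => //; apply: homspan_prod => // j.
    have [jk|kj] := ltnP j k; last first.
      have h : homspan k 0 (fun=> 0%N) (fun _ : tup => (t j == j)%:R).
        by apply: homspan_reg; apply: homreg_cst.
      apply: (homspan_ext k_gt0 n_gt0) (homspan_eq h _) _ => [j'|v].
        by rewrite /e ltnNge kj.
      by rewrite mxE ltnNge kj.
    have [tk|kt] := ltnP (t j) k; last first.
      by apply: (homspan_ext k_gt0 n_gt0) (homspan0 C k_gt0 n_gt0 _ _) _ => v; rewrite mxE jk ltnNge kt.
    have h := homspan_coord C k_gt0 n_gt0 (s j) tk.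
    apply: (homspan_ext k_gt0 n_gt0) (homspan_eq h _) _ => [j'|v]; first by rewrite /e jk.
    by rewrite mxE jk tk.
  apply: (homspan_ext k_gt0 n_gt0) h _ => v; rewrite -det_tr; apply: eq_bigr => t _.
  by congr (_ * _); apply: eq_bigr => j _; rewrite [RHS]mxE.
have h := homspan_prod k_gt0 n_gt0 (index_enum _) hdet.
by apply: homspan_eq h _ => j; rewrite -/(d j) dE.
Qed.

(** The vectors are taken on the moment curve: a row in the kernel of one of the matrices would be a
    polynomial of degree less than [k] with [k] distinct roots. *)
Lemma detk_prod_neq0 : exists v, detk_prod v != 0.
Proof.
exists (fun j => \col_i j.+1%:R ^+ i); apply/prodf_neq0 => s _.
apply/negP => /det0P[u nu u0]; move/negP: nu; apply.
have uE (j : 'I_n) : (k <= j)%N -> u 0 j = 0.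
  move=> kj; have := congr1 (fun w : 'rV_n => w 0 j) u0; rewrite !mxE => <-.
  rewrite (bigD1 j) //= mxE ltnNge kj eqxx mulr1 big1 ?addr0 // => l nl.
  by rewrite mxE ltnNge kj (negPf nl) mulr0.
pose p : {poly C} := \poly_(i < k) (if insub i is Some j then u 0 j else 0).
have p0 : p = 0.
  apply: (@roots_geq_poly_eq0 _ _ [seq (s (widen_ord kn i)).+1%:R | i <- enum 'I_k]).
  - apply/allP => _ /mapP[i _ ->]; rewrite /root horner_poly.
    have := congr1 (fun w : 'rV_n => w 0 (widen_ord kn i)) u0; rewrite !mxE.
    rewrite (big_ord_widen n (fun l : nat => (if insub l is Some j then u 0 j else 0)
      * (s (widen_ord kn i)).+1%:R ^+ l) kn) => pE; apply/eqP.
    rewrite -[RHS]pE big_mkcond; apply: eq_bigr => l _.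
    rewrite !mxE /= ltn_ord; case: ifP => //= lk; last by rewrite mulr0.
    by rewrite valK.
  - rewrite map_inj_uniq ?enum_uniq // => i j /eqP.
    by rewrite eqr_nat eqSS => /eqP/val_inj/perm_inj/(congr1 val)/= /val_inj.
  - by rewrite size_map size_enum_ord size_poly.
apply/eqP/rowP => j; rewrite mxE; have [jk|/uE//] := ltnP j k.
by have := coef_poly k (fun i => if insub i is Some j then u 0 j else 0) j;
  rewrite -/p p0 coef0 jk valK.
Qed.

Lemma S_Chow_fundamental : exists2 m : nat, (0 < m)%N &
  S_Chow C (\row_(i < n) (if (i < k)%N then m%:Z else 0)).
Proof.
have [d d_gt0 hf] := detk_prod_span.
have [D [P0 [hP0 P01 P0R]]] := homspan_integral k_gt0 n_gt0 d_gt0 hf.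
have [P [hP P1 PG PR]] := invariant_relation slk1 slkM slkA
  (fun g v => @detk_prod_slk g v) hP0 P01 P0R.
have [v0 nv0] := detk_prod_neq0.
(* The leading term of the relation is nonzero at [gtup projk v0], so some other coefficient is
   nonzero there. *)
have [i [i_gt0 iD Pi]] : exists i, [/\ (0 < i)%N, (i <= D)%N & P i (gtup projk v0) != 0].
  apply: NNPP => nex; have := PR (gtup projk v0).
  rewrite big_ord_recl P1 subn0 mul1r big1 ?addr0 => [|j _]; last first.
    have [->|nj] := eqVneq (P (lift ord0 j) (gtup projk v0)) 0; first by rewrite mul0r.
    case: nex; exists (lift ord0 j); split=> //.
    exact: (ltn_ord (lift ord0 j)).
  by apply/eqP; rewrite expf_neq0 // detk_prod_projk.
pose m := (n * (d * i))%N; pose Q v := P i (gtup projk v) ^+ k.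
have hQ : homreg (k * (d * i)) Q.
  by apply: homregX; apply: homreg_gtup (hP i iD).
exists m; first by rewrite !muln_gt0 n_gt0 d_gt0.
apply: (S_Chow_criterion hQ).
- move=> l v [l1 l0]; rewrite /Q gtupM.
  pose g : 'M[C]_n := \matrix_(a, b) if (a < k)%N && (b < k)%N then l a b else (a == b)%:R.
  have sg : slk g.
    split=> [|a b]; last first.
      by rewrite mxE (ltnNge a) (ltnNge b) => /orP[] ->; rewrite ?andbF.
    rewrite det_trig; last first.
      apply/is_trig_mxP => a b ab; rewrite mxE l0 // -val_eqE /= (ltn_eqF ab).
      by case: ifP.
    by rewrite big1 // => a _; rewrite mxE l1 eqxx; case: ifP.
  have -> : projk *m l = g *m projk.
    apply/matrixP => a b; rewrite mul_diag_mx mul_mx_diag !mxE.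
    have [ak|ka] := ltnP a k; have [bk|kb] := ltnP b k; rewrite /= ?mul1r ?mulr1 ?mul0r ?mulr0 //.
      by rewrite l0 //; apply: leq_trans kb.
    by case: eqP ka bk => // ->; rewrite leqNgt => /negPf->.
  by rewrite -gtupM PG.
- move=> t v nt; rewrite /Q gtupM.
  (* On the block, [t] is the scalar [c] times an element of [SL_k]. [P i] scales by [c ^+ m], and
     the [k]-th power in [Q] turns this into [p ^+ m]. *)
  pose p := \prod_(a : 'I_n | (a < k)%N) t 0 a; pose c := k.-root p.
  have ck : c ^+ k = p by apply: rootCK.
  have np : p != 0 by apply/prodf_neq0.
  have nc : c != 0 by apply: contraNneq np => c0; rewrite -ck c0 expr0n gtn_eqF.
  pose g : 'M[C]_n := diag_mx (\row_a if (a < k)%N then t 0 a / c else 1).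
  have sg : slk g.
    split=> [|a b].
      rewrite det_diag; under eq_bigr do rewrite mxE.
      rewrite -big_mkcond prodf_div -/p -ck.
      rewrite (big_ord_narrow kn) prodr_const card_ord divff //.
      by rewrite expf_neq0.
    case: (eqVneq a b) => [->|/negPf nab] h; rewrite !mxE ?nab ?mulr0n // eqxx mulr1n.
    by move: h; rewrite orbb leqNgt => /negPf->.
  have -> : projk *m diag_mx t = g *m c%:M *m projk.
    rewrite -[c%:M]diag_const_mx; apply/matrixP => a b.
    rewrite mul_diag_mx !mul_mx_diag !mxE.
    have [ab|nab] := eqVneq a b; last by rewrite !mulr0n mulr0 !mul0r.
    rewrite -ab !mulr1n; case: ifP => _; last by rewrite mul0r mulr0.
    by rewrite mul1r mulr1 divfK.
  rewrite -!gtupM PG // (homreg_scale _ _ (hP i iD)) exprMn; congr (_ * _).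
  rewrite -/m -exprM mulnC exprM ck /p -prodrXl [LHS]big_mkcond /=.
  apply: eq_bigr => a _; rewrite mxE.
  by case: ifP => _; rewrite ?expr0z.
- by exists v0; rewrite expf_neq0.
- move=> a b ab; rewrite !mxE; case: ifP => [bk|_]; last by case: ifP.
  by rewrite (leq_ltn_trans ab bk).
Qed.

End FundamentalWeights.

(** * Centering the ratios of the first two coordinates *)

Lemma coef_linM (K : comNzRingType) (a b : K) (p : {poly K}) i :
  ((a%:P + b *: 'X) * p)`_i.+1 = a * p`_i.+1 + b * p`_i.
Proof. by rewrite mulrDl coefD coefCM -scalerAl coefZ coefXM. Qed.

Lemma coef0_linM (K : comNzRingType) (a b : K) (p : {poly K}) :
  ((a%:P + b *: 'X) * p)`_0 = a * p`_0.
Proof. by rewrite mulrDl coefD coefCM -scalerAl coefZ coefXM mulr0 addr0. Qed.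

Lemma size_lin (K : nzRingType) (a b : K) : (size (a%:P + b *: 'X)%R <= 2)%N.
Proof.
rewrite (leq_trans (size_polyD _ _)) // geq_max size_polyC.
rewrite (leq_trans (leq_b1 _)) // (leq_trans (size_scale_leq _ _)) //.
by rewrite size_polyX.
Qed.

Lemma size_prod_lin (K : fieldType) (I : Type) (r : seq I) (P : pred I) (a b : I -> K) :
  (size (\prod_(i <- r | P i) ((a i)%:P + b i *: 'X))%R <= (size r).+1)%N.
Proof.
elim: r => [|i r IH]; first by rewrite big_nil size_poly1.
rewrite big_cons; case: ifP => _; last exact: leq_trans IH _.
apply: leq_trans (size_polyMleq _ _) _.
rewrite -subn1 leq_subLR; apply: leq_trans (leq_add (size_lin _ _) IH) _.
by rewrite add2n add1n.
Qed.

Lemma coef1_prod_lin (K : fieldType) (I : finType) (a b : I -> K) :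
  (\prod_i ((a i)%:P + b i *: 'X))`_1 = \sum_j b j * \prod_(i | i != j) a i.
Proof.
have := index_enum_uniq I; elim: (index_enum I) => [_|i r IH].
  by rewrite !big_nil coef1.
rewrite /= => /andP[ir ur]; rewrite !big_cons coef_linM IH // eqxx /=.
have -> : (\prod_(j <- r) ((a j)%:P + b j *: 'X))`_0 = \prod_(j <- r) a j.
  elim: r {IH ir ur} => [|j r IH]; first by rewrite !big_nil coef1.
  by rewrite !big_cons coef0_linM IH.
rewrite addrC; congr (_ * _ + _).
  rewrite big_seq [RHS]big_seq_cond; apply: eq_bigl => j.
  by case: (boolP (j \in r)) => //= jr; apply/esym; apply: contraNneq ir => <-.
rewrite mulr_sumr big_seq [RHS]big_seq; apply: eq_bigr => j jr.
rewrite big_cons ifT; first by rewrite mulrCA.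
by apply: contraNneq ir => ->.
Qed.

Section Interpolation.
Variables (C : numClosedFieldType) (n : nat).
Local Notation tup := ('I_n -> 'cV[C]_n).

(** By Lagrange interpolation at [0, ..., D - 1], the coefficients are combinations of values with
    weights independent of [v]. *)
Lemma homreg_interpolate N D (p : tup -> {poly C}) :
  (forall v, size (p v) <= D)%N ->
  (forall c, homreg N (fun v => (p v).[c])) ->
  forall i, homreg N (fun v => (p v)`_i).
Proof.
move=> sp hp i; have [iD|Di] := ltnP i D; last first.
  apply: homreg_ext (homreg0 _ _ _) _ => v.
  by rewrite nth_default // (leq_trans (sp v)).
pose V := Vandermonde D (\row_(j < D) j%:R : 'rV[C]_D).
have Vu : V \in unitmx.
  rewrite unitmxE det_Vandermonde unitfE.
  apply/prodf_neq0 => a _; apply/prodf_neq0 => b ab.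
  by rewrite !mxE subr_eq0 eqr_nat gtn_eqF.
have h : homreg N (fun v => \sum_(j < D) invmx V j (Ordinal iD) * (p v).[j%:R]).
  by apply: homreg_sum => j _; apply: homregZ.
apply: homreg_ext h _ => v.
pose w : 'rV_D := \row_j (p v)`_j.
have -> : (p v)`_i = w 0 (Ordinal iD) by rewrite mxE.
rewrite -[w](mulmxK Vu) [RHS]mxE; apply: eq_bigr => j _.
rewrite mulrC; congr (_ * _); rewrite mxE (horner_coef_wide _ (sp v)).
by apply: eq_bigr => l _; rewrite !mxE.
Qed.

(** The expansion in powers of [c] allows [c] to be replaced later by a function of [v]. *)
Lemma homreg_transvection N (P : tup -> C) (X : 'M[C]_n) : homreg N P ->
  exists (D : nat) (Q : nat -> tup -> C), (forall i, homreg N (Q i)) /\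
    forall c v, P (gtup (1%:M + c *: X) v) = \sum_(i < D) Q i v * c ^+ i.
Proof.
move=> hP; suff [D [p [sp pE]]] : exists D (p : tup -> {poly C}),
    (forall v, size (p v) <= D)%N /\
    forall c v, P (gtup (1%:M + c *: X) v) = (p v).[c].
  exists D, (fun i v => (p v)`_i); split.
    move=> i; apply: homreg_interpolate sp _ _ => c.
    by apply: homreg_ext (homreg_gtup (1%:M + c *: X) hP) _ => v.
  by move=> c v; rewrite pE (horner_coef_wide _ (sp v)).
elim: hP => {N P} [N P P' _ [D [p [sp pE]]] eP||N xi P _ [D [p [sp pE]]]|
    N a P P' _ [D [p [sp pE]]] _ [D' [p' [sp' pE']]]].
- by exists D, p; split=> // c v; rewrite -eP.
- by exists 1%N, (fun=> 1); split=> [v|c v]; rewrite ?size_poly1 ?hornerC.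
- pose q (v : tup) := \prod_j (((xi *m v j) 0 0)%:P + (xi *m X *m v j) 0 0 *: 'X).
  exists (n.+1 + D)%N, (fun v => q v * p v); split=> [v|c v].
    apply: leq_trans (size_polyMleq _ _) (leq_trans (leq_pred _) _).
    apply: leq_add (sp v); apply: leq_trans (size_prod_lin _ _ _ _) _.
    by rewrite /index_enum -enumT size_enum_ord.
  rewrite hornerM pE; congr (_ * _); rewrite /ev horner_prod.
  apply: eq_bigr => j _; rewrite hornerD hornerC hornerZ hornerX.
  rewrite /gtup mulmxDl mul1mx mulmxDr mxE; congr (_ + _).
  by rewrite -scalemxAl -scalemxAr mulmxA mxE mulrC.
- exists (maxn D D'), (fun v => a *: p v + p' v); split=> [v|c v].
    rewrite (leq_trans (size_polyD _ _)) // geq_max.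
    rewrite (leq_trans (size_scale_leq _ _)) ?(leq_trans (sp v)) ?leq_maxl //=.
    by rewrite (leq_trans (sp' v)) ?leq_maxr.
  by rewrite hornerD hornerZ pE pE'.
Qed.

End Interpolation.

(** * Fractions whose denominator is a power of the product of the first coordinates *)

Section LatticeGenerators.
Variables (C : numClosedFieldType) (n : nat).
Hypothesis n_gt2 : (2 < n)%N.
Local Notation tup := ('I_n -> 'cV[C]_n).
Implicit Types (v : tup) (P F G : tup -> C).

Definition o0 : 'I_n := Ordinal (ltnW (ltnW n_gt2)).
Definition o1 : 'I_n := Ordinal (ltnW n_gt2).

Definition coordprod v : C := \prod_j v j o0 0.

Lemma ev_delta i v : ev (delta_mx 0 i) v = \prod_j v j i 0.
Proof.
apply: eq_bigr => j _; rewrite mxE (bigD1 i) //= mxE !eqxx mul1r big1 ?addr0 //.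
by move=> l /negPf nl; rewrite mxE nl andbF mul0r.
Qed.

Lemma homreg_coordprod : homreg 1 coordprod.
Proof. by apply: homreg_ext (homreg_ev (delta_mx 0 o0)) _ => v; rewrite ev_delta. Qed.

Definition lin v j : {poly C} := (v j o0 0)%:P + v j o1 0 *: 'X.

Definition epoly v : {poly C} := \prod_j lin v j.

(* The derivative of [epoly] when each [v j o0 0] varies along [v j i 0]. *)
Definition bpoly (i : 'I_n) v : {poly C} :=
  \sum_j (v j i 0)%:P * \prod_(l | l != j) lin v l.

Lemma mul_delta i (w : 'cV[C]_n) : (delta_mx 0 i *m w : 'M_1) 0 0 = w i 0.
Proof.
rewrite mxE (bigD1 i) //= mxE !eqxx mul1r big1 ?addr0 //.
by move=> l /negPf nl; rewrite mxE nl andbF mul0r.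
Qed.

Lemma mul_deltaZ c i (w : 'cV[C]_n) : (c *: delta_mx 0 i *m w : 'M_1) 0 0 = c * w i 0.
Proof. by rewrite -scalemxAl mxE mul_delta. Qed.

Lemma homreg_epoly r : homreg 1 (fun v => (epoly v)`_r).
Proof.
apply: (@homreg_interpolate _ _ _ n.+1) => [v|c].
  by rewrite (leq_trans (size_prod_lin _ _ _ _)) // /index_enum -enumT size_enum_ord.
apply: homreg_ext (homreg_ev (delta_mx 0 o0 + c *: delta_mx 0 o1)) _ => v.
rewrite horner_prod; apply: eq_bigr => j _.
rewrite hornerD hornerC hornerZ hornerX mulmxDl mxE mul_delta; congr (_ + _).
by rewrite mul_deltaZ mulrC.
Qed.

Lemma homreg_bpoly i r : homreg 1 (fun v => (bpoly i v)`_r).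
Proof.
apply: (@homreg_interpolate _ _ _ n.+1) => [v|c].
  apply: (leq_trans (size_sum _ _ _)); apply/bigmax_leqP => j _.
  rewrite mul_polyC (leq_trans (size_scale_leq _ _)) //.
  by rewrite (leq_trans (size_prod_lin _ _ _ _)) // /index_enum -enumT size_enum_ord.
(* The value of [bpoly i v] at [c] is the linear coefficient of [q v], whose own values are
   evaluations of the product; this is a second interpolation. *)
pose q v := \prod_j ((v j o0 0 + v j o1 0 * c)%:P + v j i 0 *: 'X).
have hq : homreg 1 (fun v => (q v)`_1).
  apply: (@homreg_interpolate _ _ _ n.+1) => [v|d].
    by rewrite (leq_trans (size_prod_lin _ _ _ _)) // /index_enum -enumT size_enum_ord.
  apply: homreg_ext (homreg_ev (delta_mx 0 o0 + c *: delta_mx 0 o1 + d *: delta_mx 0 i)) _ => v.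
  rewrite horner_prod; apply: eq_bigr => j _.
  rewrite hornerD hornerC hornerZ hornerX 2!mulmxDl 2!mxE mul_delta.
  by rewrite !mul_deltaZ [c * _]mulrC [d * _]mulrC.
apply: homreg_ext hq _ => v; rewrite coef1_prod_lin horner_sum.
apply: eq_bigr => j _; rewrite hornerM hornerC horner_prod; congr (_ * _).
by apply: eq_bigr => l _; rewrite hornerD hornerC hornerZ hornerX.
Qed.

(* [F] is a fraction of degree [d] whose denominator is a power of
   [coordprod]. *)
Definition loc d F : Prop := exists N P, homreg (N + d) P /\
  forall v, coordprod v != 0 -> P v = coordprod v ^+ N * F v.

Lemma loc_raise d F : loc d F -> exists N, forall M, exists P,
  homreg (M + N + d) P /\
  forall v, coordprod v != 0 -> P v = coordprod v ^+ (M + N) * F v.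
Proof.
move=> [N [P [hP PE]]]; exists N => M; exists (fun v => coordprod v ^+ M * P v).
split; last by move=> v nv; rewrite PE // mulrA -exprD.
rewrite -addnA -[X in (X + _)%N]muln1; apply: homregM hP.
exact/homregX/homreg_coordprod.
Qed.

Lemma loc_homreg d P : homreg d P -> loc d P.
Proof. by move=> hP; exists 0%N, P; split=> // v _; rewrite mul1r. Qed.

Lemma locD d F G : loc d F -> loc d G -> loc d (fun v => F v + G v).
Proof.
move=> /loc_raise[N hF] /loc_raise[M hG].
have [P [hP PE]] := hF M; have [Q [hQ QE]] := hG N.
exists (M + N)%N, (fun v => P v + Q v); split.
  by apply: homregD => //; rewrite [(M + N)%N]addnC.
by move=> v nv; rewrite PE // QE // [(N + M)%N]addnC mulrDr.
Qed.

Lemma locM d e F G : loc d F -> loc e G -> loc (d + e) (fun v => F v * G v).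
Proof.
move=> [N [P [hP PE]]] [M [Q [hQ QE]]]; exists (N + M)%N, (fun v => P v * Q v).
split; first by rewrite addnACA; apply: homregM.
by move=> v nv; rewrite PE // QE // exprD mulrACA.
Qed.

Lemma locX F m : loc 0 F -> loc 0 (fun v => F v ^+ m).
Proof.
move=> hF; elim: m => [|m IH]; first exact: loc_homreg (homreg_one _ _).
have [N [P [hP PE]]] := locM hF IH.
by exists N, P; split=> // v nv; rewrite PE // exprS.
Qed.

Lemma loc_sum d m (F : nat -> tup -> C) : (forall i, loc d (F i)) ->
  loc d (fun v => \sum_(i < m) F i v).
Proof.
move=> hF; elim: m => [|m IH].
  have [N [P [hP PE]]] := loc_homreg (homreg0 C n d).
  by exists N, P; split=> // v nv; rewrite PE // big_ord0.
have [N [P [hP PE]]] := locD IH (hF m).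
by exists N, P; split=> // v nv; rewrite PE // big_ord_recr.
Qed.

Definition mean v : C := (\sum_j v j o1 0 / v j o0 0) / n%:R.

(** Multiplying the sum of the ratios by [coordprod] gives the constant coefficient of
    [bpoly o1]. *)
Lemma loc_mean : loc 0 mean.
Proof.
exists 1%N, (fun v => n%:R^-1 * (bpoly o1 v)`_0); split.
  by rewrite addn0; apply/homregZ/homreg_bpoly.
move=> v nv; rewrite expr1 /mean mulrA [RHS]mulrC; congr (_ * _).
rewrite mulr_sumr coef_sum; apply: eq_bigr => j _; rewrite coefCM.
have -> : (\prod_(l | l != j) lin v l)`_0 = \prod_(l | l != j) v l o0 0.
  elim/big_rec2: _ => [|l a p _ IH]; first by rewrite coef1.
  by rewrite coef0_linM IH.
have nj : v j o0 0 != 0 by move/prodf_neq0: nv; apply.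
by rewrite /coordprod [in RHS](bigD1 j) //= [RHS]mulrC mulrA divfK.
Qed.

Definition shear : 'M[C]_n := delta_mx o1 o0.

Definition center v := gtup (1%:M + (- mean v) *: shear) v.

Lemma loc_center d P : homreg d P -> loc d (fun v => P (center v)).
Proof.
move=> /(homreg_transvection shear)[D [Q [hQ QE]]].
have h : loc d (fun v => \sum_(i < D) Q i v * (-1 * mean v) ^+ i).
  apply: (loc_sum D (F := fun i v => Q i v * (-1 * mean v) ^+ i)) => i.
  rewrite -[d]addn0; apply: locM (loc_homreg (hQ i)) (locX _ _).
  exact: (locM (loc_homreg (homreg_cst n (-1))) loc_mean).
have [N [R [hR RE]]] := h; exists N, R; split=> // v nv.
by rewrite RE // /center QE; under eq_bigr do rewrite mulN1r.
Qed.

Lemma shearE c v j i : gtup (1%:M + c *: shear) v j i 0 =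
  v j i 0 + (if i == o1 then c * v j o0 0 else 0).
Proof.
rewrite /gtup mulmxDl mul1mx mxE -scalemxAl mxE; congr (_ + _).
rewrite mxE (bigD1 o0) //= mxE eqxx andbT big1 ?addr0 => [|l /negPf nl].
  by case: eqP; rewrite ?mul1r ?mul0r ?mulr0.
by rewrite mxE nl andbF mul0r.
Qed.

End LatticeGenerators.

(** * Generators of the weight lattice *)

Section Characters.
Variables (K : fieldType) (n : nat).
Implicit Types (mu nu : 'rV[int]_n).

Definition tchar (t : 'rV[K]_n) mu : K := \prod_i t 0 i ^ mu 0 i.

Variable t : 'rV[K]_n.
Hypothesis nt : forall i, t 0 i != 0.

Lemma tcharD mu nu : tchar t (mu + nu) = tchar t mu * tchar t nu.
Proof.
by rewrite -big_split; apply: eq_bigr => i _; rewrite mxE expfzDr.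
Qed.

Lemma tchar0 : tchar t 0 = 1.
Proof. by apply: big1 => i _; rewrite mxE expr0z. Qed.

Lemma tcharN mu : tchar t (- mu) = (tchar t mu)^-1.
Proof.
by rewrite -prodfV; apply: eq_bigr => i _; rewrite mxE invr_expz.
Qed.

Lemma tcharMn mu m : tchar t (mu *+ m) = tchar t mu ^+ m.
Proof.
by elim: m => [|m IH]; rewrite ?mulr0n ?tchar0 // mulrS exprS tcharD IH.
Qed.

Lemma tchar_delta i : tchar t (delta_mx 0 i) = t 0 i.
Proof.
rewrite /tchar (bigD1 i) //= mxE !eqxx expr1z big1 ?mulr1 // => j /negPf nj.
by rewrite mxE nj andbF expr0z.
Qed.

Lemma tchar_sum (I : Type) (r : seq I) (P : pred I) (mu : I -> 'rV[int]_n) :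
  tchar t (\sum_(i <- r | P i) mu i) = \prod_(i <- r | P i) tchar t (mu i).
Proof. by apply: (big_morph _ tcharD tchar0). Qed.

End Characters.

(** * Highest weight functions obtained by centering *)

Section CenteredFunctions.
Variables (C : numClosedFieldType) (n : nat).
Hypothesis n_gt2 : (2 < n)%N.
Local Notation tup := ('I_n -> 'cV[C]_n).
Local Notation o0 := (o0 n_gt2).
Local Notation o1 := (o1 n_gt2).
Local Notation coordprod := (coordprod n_gt2).
Local Notation mean := (mean n_gt2).
Local Notation center := (center n_gt2).
Local Notation shear := (shear C n_gt2).
Local Notation lin := (lin n_gt2).
Local Notation epoly := (epoly n_gt2).
Local Notation bpoly := (bpoly n_gt2).
Implicit Types (v : tup) (P F G : tup -> C) (l : 'M[C]_n).

Lemma lower_unitriangularM (a b : 'M[C]_n) :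
  lower_unitriangular a -> lower_unitriangular b ->
  lower_unitriangular (a *m b) /\ (a *m b) o1 o0 = a o1 o0 + b o1 o0.
Proof.
move=> [a1 a0] [b1 b0]; split; first split.
- move=> i; rewrite mxE (bigD1 i) //= a1 b1 mulr1 big1 ?addr0 // => j ji.
  case: (ltngtP i j) => ij; first by rewrite a0 // mul0r.
    by rewrite b0 // mulr0.
  by rewrite (val_inj ij) eqxx in ji.
- move=> i j ij; rewrite mxE big1 // => m _.
  have [im|mi] := ltnP i m; first by rewrite a0 // mul0r.
  by rewrite b0 ?mulr0 // (leq_ltn_trans mi).
rewrite mxE (bigD1 o0) //= b1 mulr1 (bigD1 o1) //= a1 mul1r big1 ?addr0 //.
move=> i /andP[i0 i1]; rewrite a0 ?mul0r //.
by case: i i0 i1 => [[|[|i]] hi].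
Qed.

Lemma gtup_lower0 l v j : lower_unitriangular l -> gtup l v j o0 0 = v j o0 0.
Proof.
move=> [l1 l0]; rewrite /gtup mxE (bigD1 o0) //= l1 mul1r big1 ?addr0 // => i i0.
by rewrite l0 ?mul0r //; case: i i0 => [[|i] hi].
Qed.

Lemma gtup_lower1 l v j : lower_unitriangular l ->
  gtup l v j o1 0 = l o1 o0 * v j o0 0 + v j o1 0.
Proof.
move=> [l1 l0]; rewrite /gtup mxE (bigD1 o0) //= (bigD1 o1) //= l1 mul1r.
rewrite big1 ?addr0 // => i /andP[i0 i1].
by rewrite l0 ?mul0r //; case: i i0 i1 => [[|[|i]] hi].
Qed.

Lemma coordprod_lower l v : lower_unitriangular l ->
  coordprod (gtup l v) = coordprod v.
Proof. by move=> hl; apply: eq_bigr => j _; rewrite gtup_lower0. Qed.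

Lemma n_neq0 : n%:R != 0 :> C.
Proof. by rewrite pnatr_eq0 -lt0n (ltn_trans _ n_gt2). Qed.

Lemma mean_lower l v : lower_unitriangular l -> coordprod v != 0 ->
  mean (gtup l v) = l o1 o0 + mean v.
Proof.
move=> hl nv; apply: (mulIf n_neq0); rewrite mulrDl /mean !divfK ?n_neq0 //.
have -> : l o1 o0 * n%:R = \sum_(j < n) l o1 o0.
  by rewrite sumr_const card_ord mulr_natr.
rewrite -big_split /=.
apply: eq_bigr => j _; rewrite gtup_lower0 // gtup_lower1 // mulrDl mulfK //.
by move/prodf_neq0: nv; apply.
Qed.

Lemma shear_lower c : lower_unitriangular (1%:M + c *: shear) /\
  (1%:M + c *: shear) o1 o0 = c.
Proof.
split; first split.
- move=> i; rewrite !mxE eqxx; case: eqP => [->|] /=; rewrite ?mulr0 ?addr0 //.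
- move=> i j ij; rewrite !mxE -val_eqE /= (ltn_eqF ij).
  case: eqP => [ei|]; last by rewrite mulr0 addr0.
  by case: eqP => [ej|]; [rewrite ei ej in ij|rewrite mulr0 addr0].
by rewrite !mxE !eqxx mulr1 add0r.
Qed.

Lemma shearK c : (1%:M + c *: shear) *m (1%:M + (- c) *: shear) = 1%:M.
Proof.
rewrite mulmxDl !mulmxDr !mul1mx mulmx1 -scalemxAl -scalemxAr.
by rewrite mul_delta_mx_0 // !scaler0 addr0 scaleNr subrK.
Qed.

(** [l] shifts the mean by its entry [l o1 o0], so conjugating by the two centering shears cancels
    exactly that entry. *)
Lemma center_lower l v : lower_unitriangular l -> coordprod v != 0 ->
  exists2 l', lower_unitriangular l' /\ l' o1 o0 = 0 &
    center (gtup l v) = gtup l' (center v).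
Proof.
move=> hl nv; set m' := mean (gtup l v).
have [ha a10] := shear_lower (- m'); have [hb b10] := shear_lower (mean v).
have [hlb lb10] := lower_unitriangularM hl hb.
have [hc c10] := lower_unitriangularM ha hlb.
exists ((1%:M + (- m') *: shear) *m (l *m (1%:M + mean v *: shear))).
  split=> //; rewrite c10 lb10 a10 b10 /m' mean_lower //.
  by rewrite addrC subrr.
by rewrite /center !gtupM -!mulmxA shearK mulmx1.
Qed.

Lemma gtup_diag (t : 'rV[C]_n) v j i : gtup (diag_mx t) v j i 0 = t 0 i * v j i 0.
Proof. by rewrite /gtup mul_diag_mx !mxE. Qed.

Lemma center_torus (t : 'rV[C]_n) v : (forall i, t 0 i != 0) ->
  center (gtup (diag_mx t) v) = gtup (diag_mx t) (center v).
Proof.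
move=> nt; have mt : mean (gtup (diag_mx t) v) = t 0 o1 / t 0 o0 * mean v.
  rewrite /mean mulrA mulr_sumr; congr (_ / _); apply: eq_bigr => j _.
  by rewrite !gtup_diag mulf_div.
apply: functional_extensionality => j; apply/colP => i.
rewrite gtup_diag !shearE mt !gtup_diag mulrDr; congr (_ + _).
case: eqP => [->|_]; last by rewrite mulr0.
move: (mean v) => m; rewrite !mulNr mulrN -!mulrA; congr (- (_ * _)).
by rewrite mulrCA mulKf.
Qed.

Lemma coordprod_torus (t : 'rV[C]_n) v :
  coordprod (gtup (diag_mx t) v) = t 0 o0 ^+ n * coordprod v.
Proof.
rewrite -[n in _ ^+ n]card_ord -prodr_const -big_split /=.
by apply: eq_bigr => j _; rewrite gtup_diag.
Qed.

(* [P (center v)] is invariant under the lower unitriangular group; a power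
   of [coordprod] clears its denominator. *)
Lemma S_Chow_center d P (mu : 'rV[int]_n) : homreg d P ->
  (forall l v, lower_unitriangular l -> l o1 o0 = 0 -> P (gtup l v) = P v) ->
  (forall (t : 'rV_n) v, (forall i, t 0 i != 0) ->
     P (gtup (diag_mx t) v) = tchar t mu * P v) ->
  (exists v, [/\ coordprod v != 0, mean v = 0 & P v != 0]) ->
  (forall i j : 'I_n, (0 < i)%N -> (i <= j)%N -> mu 0 j <= mu 0 i) ->
  exists N, forall M, (N <= M)%N ->
    S_Chow C (mu + delta_mx 0 o0 *+ (n * M)).
Proof.
move=> hP Pl Pt [v0 [nv0 mv0 Pv0]] dmu.
have [N0 hN0] := loc_raise (loc_center n_gt2 hP).
(* [B] bounds every entry of [mu] in absolute value; adding at least [B + B] to the first entry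
   makes it dominate the others. *)
pose B := (\sum_(j < n) absz (mu 0%R j))%N.
exists (N0.+1 + (B + B))%N => M hM.
have [P' [hP' PE']] := hN0 (M - N0.+1)%N.
have eM : (M - N0.+1 + N0).+1 = M.
  by rewrite -addnS subnK // (leq_trans (leq_addr _ _) hM).
(* The additional factor forces [R] to vanish where [coordprod] does, since nothing is known about
   [P'] there. *)
pose R v := coordprod v * P' v.
have RE v : coordprod v != 0 -> R v = coordprod v ^+ M * P (center v).
  by move=> nv; rewrite /R PE' // mulrA -exprS eM.
have R0 v : coordprod v = 0 -> R v = 0 by move=> v0'; rewrite /R v0' mul0r.
have hR : homreg (1 + (M - N0.+1 + N0 + d)) R.
  by apply: homregM => //; apply: homreg_coordprod.
apply: (S_Chow_criterion hR).
- move=> l v hl; have eY := coordprod_lower v hl.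
  have [Y0|nY] := eqVneq (coordprod v) 0; first by rewrite !R0 ?eY.
  rewrite !RE ?eY //; congr (_ * _).
  by have [l' [hl' l'0] ->] := center_lower hl nY; apply: Pl.
- move=> t v nt; have eY := coordprod_torus t v.
  have [Y0|nY] := eqVneq (coordprod v) 0.
    by rewrite !R0 ?eY ?Y0 ?mulr0.
  rewrite !RE ?eY //; last by rewrite mulf_neq0 ?expf_neq0.
  rewrite -/(tchar t _) tcharD // tcharMn // tchar_delta center_torus // Pt //.
  by rewrite exprMn -exprM mulrACA [_ * tchar _ _]mulrC.
- exists v0; rewrite RE // mulf_neq0 ?expf_neq0 //.
  by rewrite /center mv0 oppr0 scale0r addr0 gtup1.
move=> i j ij; rewrite !mxE !mulmxnE !mxE !eqxx /=.
have [i0|ni] := eqVneq i o0; last first.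
  have nj : (j == o0) = false.
    apply: contraNF ni => /eqP ej; rewrite -val_eqE /= -leqn0.
    by rewrite ej in ij.
  rewrite nj mul0rn !addr0; apply: dmu => //.
  by rewrite lt0n -[0%N]/(val o0) val_eqE.
have [->|nj] := eqVneq j o0; first by rewrite i0.
rewrite mul0rn addr0.
have le_B a : mu 0 a <= B%:Z /\ - B%:Z <= mu 0 a.
  have : `|mu 0 a| <= B%:Z.
    by rewrite -abszE lez_nat /B (bigD1 a) //= leq_addr.
  by rewrite ler_norml => /andP[].
have [hj _] := le_B j; have [_ hi] := le_B i.
have hnM : B%:Z + B%:Z <= 1 *+ (n * M).
  rewrite natz -PoszD lez_nat; apply: leq_trans (_ : M <= _)%N.
    by apply: leq_trans hM; rewrite leq_addl.
  by rewrite leq_pmull // (ltn_trans _ n_gt2).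
apply: le_trans hj _; apply: le_trans (lerD hi hnM).
by rewrite addKr.
Qed.

Lemma lin_lower l v j : lower_unitriangular l -> l o1 o0 = 0 ->
  lin (gtup l v) j = lin v j.
Proof.
by move=> hl l10; rewrite /lin gtup_lower0 // gtup_lower1 // l10 mul0r add0r.
Qed.

Lemma coef_prod_lin_torus (t : 'rV[C]_n) v (r : seq 'I_n) (Q : pred 'I_n) i :
    (forall i, t 0 i != 0) ->
  (\prod_(j <- r | Q j) lin (gtup (diag_mx t) v) j)`_i =
  t 0 o0 ^+ count Q r * (t 0 o1 / t 0 o0) ^+ i * (\prod_(j <- r | Q j) lin v j)`_i.
Proof.
move=> nt; have : t 0 o1 = t 0 o0 * (t 0 o1 / t 0 o0) by rewrite mulrCA mulfV // mulr1.
move: (t 0 o1 / t 0 o0) => u t1E; elim: r i => [|a r IH] i.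
  rewrite !big_nil coef1 /= mul1r; case: i => [|i]; first by rewrite mul1r.
  by rewrite mulr0.
rewrite !big_cons /=; case: (Q a) => //=; rewrite add1n exprS.
have linE : lin (gtup (diag_mx t) v) a =
    (t 0 o0 * v a o0 0)%:P + (t 0 o1 * v a o1 0) *: 'X.
  by rewrite /lin !gtup_diag.
case: i => [|i]; first by rewrite linE !coef0_linM IH !expr0 !mulr1 mulrACA.
by rewrite linE !coef_linM !IH exprS t1E; ring.
Qed.

Lemma epoly_torus (t : 'rV[C]_n) v i : (forall i, t 0 i != 0) ->
  (epoly (gtup (diag_mx t) v))`_i =
  t 0 o0 ^+ n * (t 0 o1 / t 0 o0) ^+ i * (epoly v)`_i.
Proof.
move=> nt; rewrite /epoly coef_prod_lin_torus // count_predT.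
by rewrite /index_enum -enumT size_enum_ord.
Qed.

Lemma bpoly_torus (t : 'rV[C]_n) v a i : (forall i, t 0 i != 0) ->
  (bpoly a (gtup (diag_mx t) v))`_i =
  t 0 a * (t 0 o0 ^+ n.-1 * (t 0 o1 / t 0 o0) ^+ i) * (bpoly a v)`_i.
Proof.
move=> nt; rewrite /bpoly !coef_sum mulr_sumr; apply: eq_bigr => j _.
rewrite !coefCM coef_prod_lin_torus // gtup_diag.
have -> : count (fun b : 'I_n => b != j) (index_enum 'I_n) = n.-1.
  have := count_predC (pred1 j) (index_enum 'I_n).
  rewrite count_uniq_mem ?index_enum_uniq // mem_index_enum.
  by rewrite [size _](_ : _ = n) => [/(congr1 predn)|]; rewrite // /index_enum -enumT size_enum_ord.
by rewrite -!mulrA; congr (_ * _); rewrite mulrCA; congr (_ * _); rewrite mulrCA.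
Qed.

Definition epoly_weight r : 'rV[int]_n :=
  delta_mx 0 o0 *+ n + (delta_mx 0 o1 - delta_mx 0 o0) *+ r.

Lemma epoly_special : exists v, [/\ coordprod v != 0, mean v = 0,
  (epoly v)`_2 != 0 & (epoly v)`_3 != 0].
Proof.
(* The ratios [1, 1, -2, 0, ...] have mean zero and give [(1 + X)^2 (1 - 2 X) = 1 - 3 X^2 - 2 X^3];
   three vectors are needed. *)
pose a (j : 'I_n) : C := if (j < 2)%N then 1 else if (j == 2 :> nat) then - 2%:R else 0.
pose v (j : 'I_n) : 'cV[C]_n := \col_i (if i == o0 then 1 else a j).
have v0 j : v j o0 0 = 1 by rewrite mxE eqxx.
have v1 j : v j o1 0 = a j by rewrite mxE.
have red (R : Type) (idx : R) (op : Monoid.com_law idx) (F : 'I_n -> R) :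
    (forall j : 'I_n, (2 < j)%N -> F j = idx) ->
    \big[op/idx]_j F j = op (F o0) (op (F o1) (F (Ordinal n_gt2))).
  move=> hF; rewrite (bigD1 o0) //= (bigD1 o1) //= (bigD1 (Ordinal n_gt2)) //=.
  rewrite big1 ?Monoid.mulm1 // => j; rewrite -!val_eqE /=.
  move=> /andP[/andP[j0 j1] j2]; apply: hF.
  by case: (nat_of_ord j) j0 j1 j2 => [|[|[|]]].
have ea : epoly v = 1 - 3%:R *: 'X^2 - 2%:R *: 'X^3.
  rewrite /epoly red => [|j j2]; last first.
    by rewrite /lin v0 v1 /a ltnNge (ltnW j2) /= gtn_eqF // scale0r addr0.
  rewrite /lin !v0 !v1 /a /= scale1r scaleNr -!mul_polyC !polyC_natr.
  by rewrite (exprS _ 2) (expr2); ring.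
exists v; split.
- by apply/prodf_neq0 => j _; rewrite v0 oner_neq0.
- rewrite /mean red => [|j j2]; last first.
    by rewrite v0 v1 /a ltnNge (ltnW j2) /= gtn_eqF // mul0r.
  by rewrite !v0 !v1 /a /= !divr1 (_ : 1 + (1 - 2%:R) = 0) ?mul0r //; ring.
- rewrite ea !coefB !coefZ !coefXn coef1 /= mulr1 mulr0 subr0 sub0r oppr_eq0.
  by rewrite pnatr_eq0.
- rewrite ea !coefB !coefZ !coefXn coef1 /= mulr1 mulr0 subr0 sub0r oppr_eq0.
  by rewrite pnatr_eq0.
Qed.

Lemma S_Chow_epoly r : (r == 2)%N || (r == 3)%N -> exists N, forall M, (N <= M)%N ->
  S_Chow C (epoly_weight r + delta_mx 0 o0 *+ (n * M)).
Proof.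
move=> r23; apply: (S_Chow_center (homreg_epoly C n_gt2 r)).
- move=> l v hl l10; suff -> : epoly (gtup l v) = epoly v by [].
  by apply: eq_bigr => j _; apply: lin_lower.
- move=> t v nt; rewrite epoly_torus // /epoly_weight tcharD // !tcharMn // tcharD //.
  by rewrite tcharN // !tchar_delta.
- have [v [nv mv e2 e3]] := epoly_special; exists v; split=> //.
  by case/orP: r23 => /eqP->.
move=> i j i0 ij; rewrite !mxE !mulmxnE !mxE !eqxx /=.
have ni : (i == o0) = false by rewrite -val_eqE /= gtn_eqF.
have nj : (j == o0) = false by rewrite -val_eqE /= gtn_eqF // (leq_trans i0).
rewrite ni nj !mul0rn !add0r !subr0.
have [j1|_] := eqVneq j o1; last by rewrite mul0rn mulrn_wge0.
suff -> : i = o1 by rewrite eqxx.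
by apply/val_inj/eqP; rewrite eqn_leq i0 andbT (leq_trans ij) // j1.
Qed.

Variable k : nat.
Hypothesis kn : (k <= n)%N.

Definition bmx v : 'M[C]_k := \matrix_(i, r) (bpoly (widen_ord kn i) v)`_r.

(** Row [i] of [bmx] contributes the [i]-th unit vector and [n.-1] times the first one; column [r]
    contributes [r] times the difference of the first two. *)
Definition bmx_weight : 'rV[int]_n := \sum_(i < k) delta_mx 0 (widen_ord kn i) +
  (delta_mx 0 o0 *+ (n.-1 * k) +
   (delta_mx 0 o1 - delta_mx 0 o0) *+ (\sum_(r < k) r)%N).

Lemma homreg_bmx : homreg k (fun v => \det (bmx v)).
Proof.
have h (s : {perm 'I_k}) (r : seq 'I_k) :
    homreg (size r) (fun v => \prod_(i <- r) bmx v i (s i)).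
  elim: r => [|i r IH].
    by apply: homreg_ext (homreg_one _ _) _ => v; rewrite big_nil.
  have := homregM (homreg_bpoly C n_gt2 (widen_ord kn i) (s i)) IH.
  by move/homreg_ext; apply=> v; rewrite big_cons mxE.
have h' : homreg k (fun v => \sum_(s : {perm 'I_k}) (-1) ^+ (odd_perm s) *
    \prod_i bmx v i (s i)).
  apply: homreg_sum => s _; apply: homregZ.
  by have := h s (index_enum 'I_k); rewrite {1}/index_enum -enumT size_enum_ord.
exact: homreg_ext h' _.
Qed.

(** The linear factors do not change, and the rows are transformed by the leading block of [l],
    which has determinant [1]. *)
Lemma bmx_lower l v : lower_unitriangular l -> l o1 o0 = 0 ->
  \det (bmx (gtup l v)) = \det (bmx v).
Proof.
move=> hl l10; have [l1 l0] := hl.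
pose L : 'M[C]_k := \matrix_(i, j) l (widen_ord kn i) (widen_ord kn j).
suff -> : bmx (gtup l v) = L *m bmx v.
  rewrite det_mulmx det_trig; last by apply/is_trig_mxP => i j ij; rewrite mxE l0.
  by rewrite big1 ?mul1r // => i _; rewrite mxE l1.
have bE a : bpoly a (gtup l v) = \sum_b (l a b)%:P * bpoly b v.
  rewrite /bpoly; under [RHS]eq_bigr do rewrite mulr_sumr.
  rewrite exchange_big; apply: eq_bigr => j _ /=.
  under [RHS]eq_bigr do rewrite mulrA -polyCM.
  rewrite -mulr_suml -rmorph_sum /gtup mxE; congr (_ * _).
  by apply: eq_bigr => m _; apply: lin_lower.
apply/matrixP => i r; rewrite !mxE bE coef_sum.
under [RHS]eq_bigr do rewrite !mxE.
rewrite (bigID (fun b : 'I_n => (b < k)%N)) /= [X in _ + X]big1 ?addr0; last first.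
  move=> b; rewrite -leqNgt coefCM => kb; rewrite l0 ?mul0r //.
  exact: leq_trans (ltn_ord i) kb.
rewrite (big_ord_narrow kn).
by apply: eq_bigr => b _; rewrite coefCM.
Qed.

Lemma bmx_torus (t : 'rV[C]_n) v : (forall i, t 0 i != 0) ->
  \det (bmx (gtup (diag_mx t) v)) = tchar t bmx_weight * \det (bmx v).
Proof.
move=> nt.
have -> : bmx (gtup (diag_mx t) v) =
    diag_mx (\row_i (t 0 (widen_ord kn i) * t 0 o0 ^+ n.-1)) *m bmx v *m
    diag_mx (\row_r (t 0 o1 / t 0 o0) ^+ r).
  apply/matrixP => i r; rewrite mul_diag_mx mul_mx_diag !mxE bpoly_torus //.
  by rewrite -!mulrA; congr (_ * (_ * _)); rewrite mulrC.
rewrite !det_mulmx !det_diag /bmx_weight !tcharD // tcharMn // tcharMn // tcharD //.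
rewrite tcharN // !tchar_delta tchar_sum // mulrAC; congr (_ * _).
rewrite [RHS]mulrA; congr (_ * _).
  under eq_bigr do rewrite mxE.
  rewrite big_split prodr_const card_ord -exprM; congr (_ * _).
  by apply: eq_bigr => i _; rewrite tchar_delta.
by under eq_bigr do rewrite mxE; rewrite prodrXr.
Qed.

(** On the moment curve with real parameters [a j], a row in the kernel is a polynomial [p] of
    degree less than [k]. It is shown orthogonal to all powers below [k] at the points [a j], hence
    to itself, so it vanishes at all [n] points. *)
Lemma bmx_neq0 : exists v, [/\ coordprod v != 0, mean v = 0 & \det (bmx v) != 0].
Proof.
pose S := (\sum_(j < n) j)%N.
(* Distinct integers with sum zero. *)
pose a (j : 'I_n) : C := (n * j)%:R - S%:R.
have a_real j : (a j)^* = a j by rewrite rmorphB /= !rmorph_nat.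
have a_inj : injective a.
  move=> i j /addIr/eqP; rewrite eqr_nat eqn_pmul2l ?(ltn_trans _ n_gt2) //.
  by move=> /eqP/val_inj.
pose v (j : 'I_n) : 'cV[C]_n := \col_i a j ^+ i.
have v0 j : v j o0 0 = 1 by rewrite mxE.
have v1 j : v j o1 0 = a j by rewrite mxE expr1.
exists v; split.
- by apply/prodf_neq0 => j _; rewrite v0 oner_neq0.
- rewrite /mean; under eq_bigr do rewrite v0 v1 divr1.
  rewrite sumrB -natr_sum -big_distrr /= -/S sumr_const card_ord natrM mulr_natl.
  by rewrite subrr mul0r.
apply/negP => /det0P[u nu u0]; move/negP: nu; apply.
pose p : {poly C} := \poly_(i < k) (if insub i is Some j then u 0 j else 0).
pose q j : {poly C} := \prod_(b | b != j) lin v b.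
have pE j : p.[a j] = \sum_(i < k) u 0 i * a j ^+ i.
  by rewrite horner_poly; apply: eq_bigr => i _; rewrite valK.
have qS j r : a j * (q j)`_r = (epoly v)`_r.+1 - (q j)`_r.+1.
  by rewrite /epoly (bigD1 j) //= -/(q j) /lin coef_linM v0 v1 mul1r [X in X - _]addrC addrK.
have q0 j : (q j)`_0 = 1.
  rewrite /q; elim/big_rec: _ => [|b s _ IH]; first by rewrite coef1.
  by rewrite /lin coef0_linM v0 mul1r.
(* For [r = 0] these are the kernel equations. The recursion [qS] trades a coefficient of [q j] for
   a power of [a j], up to a coefficient of [epoly v] that is independent of [j]. *)
have pq r s : (r + s < k)%N -> \sum_j p.[a j] * a j ^+ r * (q j)`_s = 0.
  elim: r s => [|r IH] s rs.
    have := congr1 (fun w : 'rV_k => w 0 (Ordinal rs)) u0; rewrite !mxE; apply: etrans.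
    under eq_bigr do rewrite mulr1 pE mulr_suml.
    rewrite exchange_big; apply: eq_bigr => i _ /=; rewrite mxE /bpoly coef_sum mulr_sumr.
    by apply: eq_bigr => j _; rewrite coefCM mxE mulrA.
  under eq_bigr do rewrite exprSr mulrA -mulrA qS mulrBr.
  rewrite sumrB IH ?addnS // subr0.
  have := IH 0%N; rewrite addn0 => /(_ (leq_trans _ (ltnW rs))).
  rewrite ltnS leq_addr => /(_ isT).
  under eq_bigr do rewrite q0 mulr1.
  by rewrite -mulr_suml => ->; rewrite mul0r.
have pa r : (r < k)%N -> \sum_j p.[a j] * a j ^+ r = 0.
  move=> rk; have := pq r 0%N; rewrite addn0 => /(_ rk).
  by under eq_bigr do rewrite q0 mulr1.
have pa0 j : p.[a j] = 0.
  have : \sum_j p.[a j] * (p.[a j])^* = 0.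
    transitivity (\sum_j \sum_(i < k) (u 0 i)^* * (p.[a j] * a j ^+ i)).
      apply: eq_bigr => b _; rewrite {2}pE rmorph_sum mulr_sumr.
      by apply: eq_bigr => i _; rewrite rmorphM rmorphXn /= a_real mulrCA.
    rewrite exchange_big big1 // => i _; rewrite -mulr_sumr pa //.
    by rewrite mulr0.
  move/eqP; rewrite psumr_eq0 => [/allP h|b _]; last exact: mul_conjC_ge0.
  by have := h j (mem_index_enum _); rewrite mul_conjC_eq0 => /eqP.
have p0 : p = 0.
  apply: (@roots_geq_poly_eq0 _ _ [seq a i | i <- enum 'I_n]).
  - by apply/allP => _ /mapP[i _ ->]; rewrite /root pa0.
  - by rewrite map_inj_uniq ?enum_uniq.
  - by rewrite size_map size_enum_ord (leq_trans (size_poly _ _)).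
apply/eqP/rowP => j; rewrite mxE.
by have := coef_poly k (fun i => if insub i is Some j then u 0 j else 0) j;
  rewrite -/p p0 coef0 ltn_ord valK.
Qed.

Lemma S_Chow_bmx : exists N, forall M, (N <= M)%N ->
  S_Chow C (bmx_weight + delta_mx 0 o0 *+ (n * M)).
Proof.
apply: (S_Chow_center homreg_bmx bmx_lower bmx_torus bmx_neq0).
move=> i j i0 ij.
have ni : (i == o0) = false by rewrite -val_eqE /= gtn_eqF.
have nj : (j == o0) = false by rewrite -val_eqE /= gtn_eqF // (leq_trans i0).
have sumE (a : 'I_n) : (\sum_(b < k) delta_mx 0 (widen_ord kn b) : 'rV[int]_n) 0 a =
    Posz (a < k)%N.
  rewrite summxE; under eq_bigr do rewrite mxE eqxx /=.
  have [ak|ka] := ltnP a k.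
    rewrite (bigD1 (Ordinal ak)) //= -val_eqE eqxx big1 // => b.
    by rewrite -!val_eqE /= eq_sym => /negPf->.
  rewrite big1 // => b _; rewrite -val_eqE /= gtn_eqF //.
  exact: leq_trans (ltn_ord b) ka.
rewrite ![bmx_weight _ _]mxE !sumE; apply: lerD.
  rewrite lez_nat; have [jk|//] := ltnP j k.
  by rewrite (leq_ltn_trans ij jk).
rewrite !mxE !mulmxnE !mxE !eqxx /= ni nj !mul0rn !add0r !subr0.
have [j1|_] := eqVneq j o1; last by rewrite mul0rn mulrn_wge0.
suff -> : i = o1 by rewrite eqxx.
by apply/val_inj/eqP; rewrite eqn_leq i0 andbT (leq_trans ij) // j1.
Qed.

End CenteredFunctions.

(** * Saturation *)

Section GeneratedGroup.
Variables (n : nat) (T : 'rV[int]_n -> Prop).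
Hypothesis mT : submonoid T.

Lemma submonoidMn x m : T x -> T (x *+ m).
Proof.
move=> Tx; elim: m => [|m IH]; first by case: mT.
by rewrite mulrS; apply: (proj2 mT).
Qed.

Lemma submonoid_sum (I : Type) (r : seq I) (P : pred I) (x : I -> 'rV[int]_n) :
  (forall i, P i -> T (x i)) -> T (\sum_(i <- r | P i) x i).
Proof. by move=> Tx; elim/big_ind: _ => //; case: mT. Qed.

Local Notation A := (gen_group T).

Lemma gen_group_in x : T x -> A x.
Proof. by move=> Tx; exists x, 0; split; rewrite ?subr0 //; case: mT. Qed.

Lemma gen_groupD x y : A x -> A y -> A (x + y).
Proof.
move=> [a [b [Ta Tb ->]]] [c [d [Tc Td ->]]]; exists (a + c), (b + d).
by split; rewrite ?opprD 1?addrACA //; apply: (proj2 mT).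
Qed.

Lemma gen_groupN x : A x -> A (- x).
Proof. by move=> [a [b [Ta Tb ->]]]; exists b, a; split=> //; rewrite opprB. Qed.

Lemma gen_groupB x y : A x -> A y -> A (x - y).
Proof. by move=> Ax Ay; apply/gen_groupD/gen_groupN. Qed.

Lemma gen_groupMn x m : A x -> A (x *+ m).
Proof.
move=> Ax; elim: m => [|m IH]; last by rewrite mulrS; apply: gen_groupD.
by apply: gen_group_in; case: mT.
Qed.

Lemma gen_groupZ x (m : int) : A x -> A (m *: x).
Proof.
move=> Ax; rewrite -[m]intz scaler_int.
by case: m => m; [|apply: gen_groupN]; apply: gen_groupMn.
Qed.

Lemma gen_group_sum (I : Type) (r : seq I) (P : pred I) (x : I -> 'rV[int]_n) :
  (forall i, P i -> A (x i)) -> A (\sum_(i <- r | P i) x i).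
Proof.
move=> Ax; elim/big_ind: _ => //; last exact: gen_groupD.
by apply: gen_group_in; case: mT.
Qed.

End GeneratedGroup.

Section Saturation.
Variables (C : numClosedFieldType) (n : nat).
Hypothesis n_gt2 : (2 < n)%N.
Variable T : 'rV[int]_n -> Prop.
Hypotheses (mT : submonoid T) (ST : forall x, S_Chow C x -> T x).
Local Notation A := (gen_group T).
Local Notation o0 := (o0 n_gt2).
Local Notation o1 := (o1 n_gt2).
Local Notation e i := (delta_mx 0 i : 'rV[int]_n).

(** Two consecutive values of [M] differ by [e o0 *+ n], which can then be subtracted off. *)
Lemma lattice_shift mu : (exists N, forall M, (N <= M)%N -> S_Chow C (mu + e o0 *+ (n * M))) ->
  A (e o0 *+ n) /\ A mu.
Proof.
move=> [N hN].
have h0 : A (mu + e o0 *+ (n * N)) by apply/gen_group_in/ST/hN.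
have h1 : A (mu + e o0 *+ (n * N.+1)) by apply/gen_group_in/ST/hN.
have An : A (e o0 *+ n).
  have -> : e o0 *+ n = (mu + e o0 *+ (n * N.+1)) - (mu + e o0 *+ (n * N)).
    by rewrite mulnS mulrnDr addrCA addrK.
  exact: gen_groupB.
split=> //; rewrite -(addrK (e o0 *+ (n * N)) mu); apply: gen_groupB => //.
by rewrite mulrnA; apply: gen_groupMn.
Qed.

Lemma gen_group_root i : A (e i - e o0).
Proof.
have [An A2] := lattice_shift (S_Chow_epoly C n_gt2 (isT : (2 == 2)%N || (2 == 3)%N)).
have [_ A3] := lattice_shift (S_Chow_epoly C n_gt2 (isT : (3 == 2)%N || (3 == 3)%N)).
have A1 : A (e o1 - e o0).
  have -> : e o1 - e o0 = epoly_weight n_gt2 3 - epoly_weight n_gt2 2.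
    by rewrite /epoly_weight mulrSr addrA [RHS]addrC addKr.
  exact: gen_groupB.
(* Modulo [e o1 - e o0] and [e o0 *+ n], this sum is the weight of the determinant of size [k]. The
   differences for consecutive [k] isolate a single term. *)
have AB k (kn : (k <= n)%N) : A (\sum_(b < k) (e (widen_ord kn b) - e o0)).
  have [_ hB] := lattice_shift (S_Chow_bmx C n_gt2 kn).
  have -> : \sum_(b < k) (e (widen_ord kn b) - e o0) = bmx_weight n_gt2 kn
      - ((e o1 - e o0) *+ (\sum_(r < k) r)%N + (e o0 *+ n) *+ k).
    rewrite /bmx_weight sumrB sumr_const card_ord opprD addrA addrA addrK.
    rewrite -addrA; congr (_ + _).
    have nE : (n * k = k + n.-1 * k)%N by rewrite -{1}(prednK (ltnW (ltnW n_gt2))) mulSn.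
    by rewrite -mulrnA nE mulrnDr opprD addrCA subrr addr0.
  apply: gen_groupB => //; apply: gen_groupD => //; exact: gen_groupMn.
have hi := ltn_ord i; have hi' := ltnW hi.
have -> : e i - e o0 = \sum_(b < i.+1) (e (widen_ord hi b) - e o0) -
    \sum_(b < i) (e (widen_ord hi' b) - e o0).
  rewrite big_ord_recr /= [RHS]addrAC.
  rewrite [X in _ = X - _ + _](_ : _ = \sum_(b < i) (e (widen_ord hi' b) - e o0)).
    by rewrite subrr add0r; congr (e _ - _); apply/val_inj.
  by apply: eq_bigr => b _; congr (e _ - _); apply/val_inj.
exact: gen_groupB.
Qed.

(** [lam] is a combination of the [e i - e o0] plus [wsize lam] times [e o0], and the latter is a
    multiple of [e o0 *+ n]. *)
Lemma gen_group_size lam : (wsize lam = 0 %[mod n])%Z -> A lam.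
Proof.
move=> hl; have [An _] := lattice_shift (S_Chow_epoly C n_gt2 (isT : (2 == 2)%N || (2 == 3)%N)).
have -> : lam = \sum_i lam 0 i *: (e i - e o0) + wsize lam *: e o0.
  under eq_bigr do rewrite scalerBr.
  by rewrite sumrB -scaler_suml subrK -row_sum_delta.
apply: gen_groupD => //.
  by apply: gen_group_sum => // i _; apply/gen_groupZ/gen_group_root.
rewrite (divz_eq (wsize lam) n) hl mod0z addr0 -scalerA -[n%:Z]natz scaler_nat.
exact: gen_groupZ.
Qed.

(** A partition is the combination of fundamental weights with its successive differences as
    coefficients; the product of all the [m k] clears the multiples. *)
Lemma partition_multiple lam : is_partition lam ->
  exists2 m, (0 < m)%N & T (lam *+ m).
Proof.
move=> [dl pl].
have /fin_all_exists2[m m_gt0 mS] (k : 'I_n) : exists2 m : nat, (0 < m)%N &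
    S_Chow C (\row_(i < n) (if (i < k.+1)%N then m%:Z else 0)).
  exact: S_Chow_fundamental.
(* The value [0] past the end makes the last difference equal to the last part of [lam]. *)
pose f (a : nat) : int := if insub a is Some i then lam 0 i else 0.
have fE (i : 'I_n) : f i = lam 0 i by rewrite /f valK.
have fn : f n = 0 by rewrite /f insubF ?ltnn.
pose c (k : nat) := f k - f k.+1.
have c_ge0 (k : 'I_n) : 0 <= c k.
  rewrite subr_ge0 fE /f; case: insubP => [j _ jk|_]; last exact: pl.
  by apply: dl; rewrite jk.
exists (\prod_k m k)%N; first by apply: prodn_gt0.
pose w (k : 'I_n) : 'rV[int]_n := \row_i (if (i < k.+1)%N then (m k)%:Z else 0).
have -> : lam *+ (\prod_k m k)%N =
    \sum_k w k *+ (absz (c k) * \prod_(l | l != k) m l)%N.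
  apply/rowP => i; rewrite mulmxnE summxE.
  transitivity ((\sum_(k < n | (i <= k)%N) c k) * (\prod_k m k)%N%:Z).
    rewrite -(big_geq_mkord i n predT c) /= -[LHS]mulr_natr natz; congr (_ * _).
    have -> : \sum_(i <= k < n) c k = - (f n - f i).
      rewrite -(telescope_sumr f (ltnW (ltn_ord i))) -sumrN.
      by apply: eq_bigr => k _; rewrite opprB.
    by rewrite fn sub0r opprK fE.
  rewrite mulr_suml big_mkcond; apply: eq_bigr => k _.
  rewrite mulmxnE mxE ltnS; case: ifP => _; last by rewrite mul0rn.
  rewrite (bigD1 k) //= -mulr_natr natz !PoszM gez0_abs //.
  by rewrite mulrCA.
apply: submonoid_sum => // k _; apply: submonoidMn => //; exact/ST/mS.
Qed.

Lemma saturation_partition lam : saturated T -> is_partition lam ->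
  (wsize lam = 0 %[mod n])%Z -> T lam.
Proof.
move=> sT pl hl; have [m m_gt0 Tm] := partition_multiple pl.
exact: sT (gen_group_size hl) m_gt0 Tm.
Qed.

End Saturation.

Theorem theorem3p2 (R : realType) (n : nat) (hn : (2 < n)%N)
    (lam : 'rV[int]_n) :
  Sat (@S_Chow R[i] n) lam <->
  (is_partition lam /\ (wsize lam = 0 %[mod n])%Z).
Proof.
split=> [|[pl hl] T mT sT ST]; last first.
  exact: (saturation_partition hn mT ST sT pl hl).
move=> /(_ _ (@partition_submonoid n) (@partition_saturated n)); apply=> mu.
by apply: S_Chow_partition; rewrite (ltn_trans _ hn).
Qed.
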